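(* Let $\lambda_1,\lambda_2:\mathbb{R}\to\mathbb{R}$ be smooth with $\lambda_1(\tau)<\lambda_2(\tau)$, $|\lambda_1'(\tau)|<1$, $|\lambda_2'(\tau)|<1$ for all $\tau\in\mathbb{R}$; let $\ell_i:=\{(\tau,\lambda_i(\tau))\mid\tau\in\mathbb{R}\}$ and $$\mathcal{U}^\ell:=\{(\tau,y)\in\mathbb{R}^{1+1}\mid\lambda_1(\tau)<y<\lambda_2(\tau)\}.$$ Let $\mathcal{X}\in C^\infty(\overline{\mathcal{U}^\ell};\mathbb{R}^{1+1})$, $V\in C^\infty(\overline{\mathcal{U}^\ell})$, and fix $\tau_-,\tau_{+,1},\tau_{+,2}\in\mathbb{R}$. Assume: (i) there exists $T_1>0$ such that $\lambda_2(\tau_-)-T_1=\lambda_1(\tau_-+T_1)$; (ii) there exists $T_2>0$ such that $\lambda_1(\tau_-)+T_2=\lambda_2(\tau_-+T_2)$; (iii) $\tau_{+,1}>\tau_-+T_1$ and $\tau_{+,2}>\tau_-+T_2$. Then there is a constant $C>0$ depending only on $\ell_1,\ell_2,\tau_-,\tau_{+,1},\tau_{+,2},V,\mathcal{X}$ such that, for any solution $\phi\in C^2(\mathcal{U}^\ell)\cap C^1(\overline{\mathcal{U}^\ell})$ of $(\Box\phi+\nabla_{\mathcal{X}}\phi+V\phi)|_{\mathcal{U}^\ell}=0$ that also satisfies $\phi|_{\ell_1\cup\ell_2}=0$, and for each $\tau\in\{\tau_-,\tau_{+,1},\tau_{+,2}\}$, $$\int_{\mathcal{U}^\ell\cap\{t=\tau\}}(|\nabla_{t,x}\phi|^2+\phi^2)\le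 C\sum_{i=1}^2\int_{\ell_i\cap\{\tau_-<t<\tau_{+,i}\}}|\partial_x\phi|^2 .$$
   Context: $\mathbb{R}^{1+1}$ has coordinates $(t,x)$ and Minkowski metric $g=-dt^2+dx^2$; $\Box=-\partial_{tt}^2+\partial_{xx}^2$; $\nabla_{\mathcal{X}}\phi$ is the derivative of $\phi$ along $\mathcal{X}$; $|\nabla_{t,x}\phi|^2:=(\partial_t\phi)^2+(\partial_x\phi)^2$. Integrals over curves use the length measure induced by $g$ (for $\ell_i$: $\sqrt{1-|\lambda_i'|^2}\,d\tau$). Condition (i) says that the forward, leftward null ray from $(\tau_-,\lambda_2(\tau_-))\in\ell_2$ meets $\ell_1$ at time $\tau_-+T_1$; (ii) says that the forward, rightward null ray from $(\tau_-,\lambda_1(\tau_-))\in\ell_1$ meets $\ell_2$ at time $\tau_-+T_2$. *)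

(* Defs.v *)
From Stdlib Require Import Reals.
From Coquelicot Require Import Coquelicot.
Open Scope R_scope.

(* A point of R^{1+1} is the pair (t, x); scalar functions on R^{1+1} are
   curried, f t x, as in Coquelicot's two-variable calculus. *)

Definition smooth (l : R -> R) : Prop := forall (n : nat) (s : R), ex_derive_n l n s.

Definition curve (l : R -> R) (p : R * R) : Prop := snd p = l (fst p).

Definition region (l1 l2 : R -> R) (p : R * R) : Prop :=
  l1 (fst p) < snd p < l2 (fst p).

Definition closure (D : R * R -> Prop) (p : R * R) : Prop :=
  forall eps : posreal, exists q : R * R, ball p eps q /\ D q.

(* C^k(D), for an open set D. *)
Definition Ck (k : nat) (D : R * R -> Prop) (f : R -> R -> R) : Prop :=
  forall p : R * R, D p -> ex_diff_n f k (fst p) (snd p).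

(* C^k(closure D), for an open set D: f is continuous on closure D, is C^k in D,
   and its partial derivatives of order at most k in D extend continuously to
   closure D. By symmetry of the derivatives in D, it is enough to take x
   derivatives first.  Values of f off closure D play no role. *)
Definition Ck_closure (k : nat) (D : R * R -> Prop) (f : R -> R -> R) : Prop :=
  continuous_on (closure D) (uncurry f) /\
  Ck k D f /\
  forall m n : nat, (m + n <= k)%nat ->
    exists g : R * R -> R,
      continuous_on (closure D) g /\
      forall p : R * R, D p -> g p = partial_derive m n f (fst p) (snd p).

Definition Cinf_closure (D : R * R -> Prop) (f : R -> R -> R) : Prop :=
  forall k : nat, Ck_closure k D f.

Definition Cinf_closure_field (D : R * R -> Prop) (X : R -> R -> R * R) : Prop :=
  Cinf_closure D (fun t x => fst (X t x)) /\
  Cinf_closure D (fun t x => snd (X t x)).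

Definition pd_t (f : R -> R -> R) (t x : R) : R := Derive (fun s => f s x) t.
Definition pd_x (f : R -> R -> R) (t x : R) : R := Derive (fun y => f t y) x.

Definition box (f : R -> R -> R) (t x : R) : R :=
  - Derive_n (fun s => f s x) 2 t + Derive_n (fun y => f t y) 2 x.

Definition nabla (X : R -> R -> R * R) (f : R -> R -> R) (t x : R) : R :=
  fst (X t x) * pd_t f t x + snd (X t x) * pd_x f t x.

(* The value at p of the continuous extension of f from D to closure D.  It is
   used for derivatives of functions in C^1(closure D) at boundary points, where
   the two-sided Derive would depend on values off closure D. *)
Definition trace (D : R * R -> Prop) (f : R -> R -> R) (p : R * R) : R :=
  lim (T := R_CompleteSpace) (filtermap (uncurry f) (within D (locally p))).

Lemma trace_correct (D : R * R -> Prop) (f : R -> R -> R) (p : R * R) (v : R) :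
  closure D p ->
  filterlim (uncurry f) (within D (locally p)) (locally v) ->
  trace D f p = v.
Proof.
intros Hp Hv.
assert (HF : ProperFilter (within D (locally p))).
{ split.
  - intros P [eps He]. destruct (Hp eps) as [q [Hq HD]].
    exists q. exact (He q Hq HD).
  - apply within_filter, locally_filter. }
assert (HG : ProperFilter (filtermap (uncurry f) (within D (locally p)))).
{ now apply filtermap_proper_filter. }
assert (Hc : cauchy (filtermap (uncurry f) (within D (locally p)))).
{ intros eps. exists v. apply Hv. now exists eps. }
apply (is_filter_lim_unique
         (F := filtermap (uncurry f) (within D (locally p))) (K := R_AbsRing)
         (V := R_NormedModule)).
- intros P [eps He]. generalize (complete_cauchy _ HG Hc eps).
  apply filter_imp. exact He.
- exact Hv.
Qed.

(* The slice at t = tau of the region is the segment ]l1 tau, l2 tau[, whose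
   induced length measure is dx. *)
Definition slice_energy (l1 l2 : R -> R) (f : R -> R -> R) (tau : R) : R :=
  RInt (fun x => (pd_t f tau x) ^ 2 + (pd_x f tau x) ^ 2 + (f tau x) ^ 2)
    (l1 tau) (l2 tau).

(* Integral of h over the part a < t < b of the timelike curve l, for the
   length measure induced by -dt^2 + dx^2. *)
Definition curve_integral (l : R -> R) (a b : R) (h : R * R -> R) : R :=
  RInt (fun s => h (s, l s) * sqrt (1 - (Rabs (Derive l s)) ^ 2)) a b.

(* Main.v *)
Require Import Defs.
From Stdlib Require Import Reals Lra.
From Coquelicot Require Import Coquelicot.
Open Scope R_scope.

(** The proof is by energy estimates. Write t0 for the time tm and w for the solution, and
consider the rays issuing from the ends of the slice t = t0 into the strip: the
rightward one from l1 and the leftward one from l2. They cross at time tP, where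
tP - t0 is half the width of the slice, then continue to l2 and l1, where they arrive
at times t0 + T2 and t0 + T1.

On the triangle bounded by l1 and the two rays, the equation can be solved sideways,
with x in the role of time: l1 is then the initial curve, and the data there are w = 0
and w_x. This bounds the energy of w on the part of the first ray before the crossing
by the integral of w_x^2 over l1 up to t0 + T1 ([sideways_estimate]). The mirror image
of this argument bounds the energy on the other ray by the data on l2 up to t0 + T2
([reflection], [boundary_control]). The slice t = t0 and the two rays up to their
crossing bound a third triangle, and the usual energy estimate, backwards in time,
bounds the energy of the slice by that on the rays ([characteristic_estimate]).

It remains to propagate the energy from t0 to later times. The multiplier d/dt would
leave boundary terms of an undetermined sign, as the curves move. It is replaced by
the timelike field d/dt + m d/dx with m >= l1' on l1 and m <= l2' on l2, for which the
boundary terms have a favourable sign ([forward_estimate]). So the same constant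
serves for every time between tm and the larger of the two final times.

All estimates are instances of one inequality ([multiplier_inequality]), with different
multipliers A d/dt + B d/dx: a large exponential rate in the multiplier absorbs the
lower order terms of the equation. It rests on a divergence theorem stated for
differential inequalities ([flux_inequality]), which is where the assumption that
solutions are C^2 only inside the strip, and C^1 up to its boundary, is dealt with. *)

(** * Continuity in the plane *)

Definition plane_continuous (f : R -> R -> R) : Prop :=
  forall t x : R, continuity_2d_pt f t x.

Lemma continuity_2d_pt_comp (f p q : R -> R -> R) (t x : R) :
  continuity_2d_pt p t x -> continuity_2d_pt q t x ->
  continuity_2d_pt f (p t x) (q t x) ->
  continuity_2d_pt (fun u v => f (p u v) (q u v)) t x.
Proof.
intros Hp Hq Hf eps.
destruct (Hf eps) as [d Hd].
generalize (locally_2d_and _ _ t x (Hp d) (Hq d)).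
apply locally_2d_impl, locally_2d_forall.
intros u v [H1 H2]. now apply Hd.
Qed.

Lemma continuity_2d_pt_slice_x (f : R -> R -> R) (t x : R) :
  continuity_2d_pt f t x -> continuous (f t) x.
Proof.
intros Hf. apply continuity_pt_filterlim, continuity_pt_locally.
intros eps. destruct (Hf eps) as [d Hd].
exists d. intros y Hy. apply Hd; [|exact Hy].
rewrite Rminus_eq_0, Rabs_R0. apply cond_pos.
Qed.

Lemma continuity_2d_pt_slice_t (f : R -> R -> R) (t x : R) :
  continuity_2d_pt f t x -> continuous (fun s => f s x) t.
Proof.
intros Hf. apply continuity_pt_filterlim, continuity_pt_locally.
intros eps. destruct (Hf eps) as [d Hd].
exists d. intros y Hy. apply Hd; [exact Hy|].
rewrite Rminus_eq_0, Rabs_R0. apply cond_pos.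
Qed.

Lemma continuity_2d_pt_of_t (g : R -> R) (t x : R) :
  continuous g t -> continuity_2d_pt (fun u _ => g u) t x.
Proof.
intros Hg. apply (continuity_1d_2d_pt_comp g (fun u _ => u)).
- now apply continuity_pt_filterlim.
- apply continuity_2d_pt_id1.
Qed.

Lemma continuity_2d_pt_of_x (g : R -> R) (t x : R) :
  continuous g x -> continuity_2d_pt (fun _ v => g v) t x.
Proof.
intros Hg. apply (continuity_1d_2d_pt_comp g (fun _ v => v)).
- now apply continuity_pt_filterlim.
- apply continuity_2d_pt_id2.
Qed.

Lemma is_derive_continuous (g : R -> R) (t l : R) : is_derive g t l -> continuous g t.
Proof. intros Hg. apply (ex_derive_continuous (V := R_NormedModule)). now exists l. Qed.

Lemma continuous_along (g : R -> R -> R) (c : R -> R) (t : R) :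
  plane_continuous g -> continuous c t -> continuous (fun s => g s (c s)) t.
Proof.
intros Hg Hc.
apply (continuity_2d_pt_slice_x (fun _ s => g s (c s)) 0 t).
apply (continuity_2d_pt_comp g (fun _ s => s) (fun _ s => c s)).
- apply continuity_2d_pt_id2.
- now apply continuity_2d_pt_of_x.
- apply Hg.
Qed.

Lemma plane_continuous_interpolation (p q : R -> R) :
  (forall t, continuous p t) -> (forall t, continuous q t) ->
  plane_continuous (fun z t => (1 - z) * p t + z * q t).
Proof.
intros Hp Hq z t.
apply continuity_2d_pt_plus; apply continuity_2d_pt_mult;
  try now apply continuity_2d_pt_of_x.
- apply continuity_2d_pt_minus; [apply continuity_2d_pt_const|apply continuity_2d_pt_id1].
- apply continuity_2d_pt_id1.
Qed.

Lemma is_derive_interpolation (p q : R -> R) (z t dp dq : R) :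
  is_derive p t dp -> is_derive q t dq ->
  is_derive (fun t => (1 - z) * p t + z * q t) t ((1 - z) * dp + z * dq).
Proof.
intros Hp Hq. apply (is_derive_plus (V := R_NormedModule)); now apply is_derive_scal.
Qed.

Lemma continuity_2d_pt_Rmax (f g : R -> R -> R) (t x : R) :
  continuity_2d_pt f t x -> continuity_2d_pt g t x ->
  continuity_2d_pt (fun u v => Rmax (f u v) (g u v)) t x.
Proof.
intros Hf Hg.
(* max (a, b) = (a + b + |a - b|) / 2 *)
apply (continuity_2d_pt_ext (fun u v => / 2 * (f u v + g u v + Rabs (f u v - g u v)))).
- intros u v. unfold Rmax, Rabs. destruct (Rle_dec _ _), (Rcase_abs _); lra.
- apply continuity_2d_pt_mult; [apply continuity_2d_pt_const|].
  apply continuity_2d_pt_plus; [now apply continuity_2d_pt_plus|].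
  apply (continuity_1d_2d_pt_comp Rabs); [apply Rcontinuity_abs|].
  now apply continuity_2d_pt_minus.
Qed.

Lemma continuous_bounded (f : R -> R) (a b : R) :
  a <= b -> (forall t, continuous f t) ->
  exists s, a <= s <= b /\ forall t, a <= t <= b -> Rabs (f t) <= Rabs (f s).
Proof.
intros Hab Hf.
destruct (continuity_ab_maj (fun t => Rabs (f t)) a b Hab) as [s [Hs Hin]].
- intros t _. apply (continuity_pt_comp f Rabs); [|apply Rcontinuity_abs].
  apply continuity_pt_filterlim, Hf.
- exists s. split; [exact Hin|exact Hs].
Qed.

Lemma plane_continuous_bounded (g : R -> R -> R) (a b c d : R) :
  plane_continuous g -> a <= b -> c <= d ->
  exists M, 0 <= M /\ forall t x, a <= t <= b -> c <= x <= d -> Rabs (g t x) <= M.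
Proof.
intros Hg Hab Hcd.
destruct (uniform_continuity_2d g a b c d (fun t x _ _ => Hg t x) (mkposreal 1 Rlt_0_1))
  as [r Hr]; simpl in Hr.
assert (Hp := cond_pos r).
(* Walking from the corner (a, c) by steps of length r / 2, each of which changes
   g by less than 1, needs at most n + 1 steps. *)
assert (Hstep : forall n : nat, forall t x, a <= t <= b -> c <= x <= d ->
  t - a < INR (S n) * (r / 2) -> x - c < INR (S n) * (r / 2) ->
  Rabs (g t x) <= Rabs (g a c) + INR (S n)).
{ induction n as [|n IH]; intros t x Ht Hx Hnt Hnx.
  - simpl in Hnt, Hnx. assert (H : Rabs (g t x - g a c) < 1).
    { apply Hr; try lra; rewrite Rabs_right; lra. }
    assert (H' := Rabs_triang_inv (g t x) (g a c)). simpl. lra.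
  - rewrite S_INR in Hnt, Hnx |- *.
    assert (Hn : 1 <= INR (S n)) by (rewrite S_INR; generalize (pos_INR n); lra).
    assert (Hback : forall y y0 y1, y0 <= y <= y1 -> y - y0 < (INR (S n) + 1) * (r / 2) ->
      exists y', y0 <= y' <= y1 /\ Rabs (y - y') < r /\ y' - y0 < INR (S n) * (r / 2)).
    { intros y y0 y1 Hy Hny. exists (Rmax y0 (y - r / 2)).
      unfold Rmax. destruct (Rle_dec _ _); split; try lra; split; try nra; apply Rabs_def1; lra. }
    destruct (Hback t a b Ht Hnt) as [t' [Ht' [Htt' Hnt']]].
    destruct (Hback x c d Hx Hnx) as [x' [Hx' [Hxx' Hnx']]].
    assert (H := IH t' x' Ht' Hx' Hnt' Hnx').
    assert (H1 : Rabs (g t x - g t' x') < 1) by (apply Hr; assumption).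
    assert (H2 := Rabs_triang_inv (g t x) (g t' x')). lra. }
destruct (INR_unbounded (((b - a) + (d - c)) / (r / 2))) as [n Hn].
exists (Rabs (g a c) + INR (S n)). split.
- assert (H := Rabs_pos (g a c)). assert (H' := pos_INR (S n)). lra.
- intros t x Ht Hx.
  assert (H : (b - a) + (d - c) < INR (S n) * (r / 2)).
  { apply Rgt_lt, (Rmult_lt_compat_r (r / 2)) in Hn; [|lra].
    replace (((b - a) + (d - c)) / (r / 2) * (r / 2)) with ((b - a) + (d - c)) in Hn by (field; lra).
    rewrite S_INR. nra. }
  apply Hstep; lra.
Qed.

Lemma nonneg_at_0 (h : R -> R) (d : R) :
  0 < d -> continuous h 0 -> (forall z, 0 < z < d -> 0 <= h z) -> 0 <= h 0.
Proof.
intros Hd Hc Hz. apply Rnot_lt_le. intros Hneg.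
apply continuity_pt_filterlim in Hc.
assert (He : 0 < - h 0) by lra.
destruct (proj1 (continuity_pt_locally _ _) Hc (mkposreal _ He)) as [r Hr].
assert (Hp := cond_pos r).
assert (Hm : 0 < Rmin r d) by now apply Rmin_glb_lt.
assert (Hm1 := Rmin_l r d). assert (Hm2 := Rmin_r r d).
assert (H := Hr (Rmin r d / 2)).
assert (H' : Rabs (h (Rmin r d / 2) - h 0) < - h 0).
{ apply H. change (Rabs (Rmin r d / 2 - 0) < r). rewrite Rminus_0_r, Rabs_right; lra. }
apply Rabs_def2 in H'. specialize (Hz (Rmin r d / 2)). lra.
Qed.

Ltac solve_continuous :=
  repeat match goal with
  | H : forall t, continuous ?f t |- continuous ?f _ => apply H
  | |- continuous (fun _ => ?c) _ => apply continuous_const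
  | |- continuous (fun s => s) _ => apply continuous_id
  | |- continuous (fun s => _ + _) _ => apply (continuous_plus (V := R_NormedModule))
  | |- continuous (fun s => _ - _) _ => apply (continuous_minus (V := R_NormedModule))
  | |- continuous (fun s => - _) _ => apply (continuous_opp (V := R_NormedModule))
  | |- continuous (fun s => _ * _) _ => apply (continuous_mult (K := R_AbsRing))
  | |- continuous (fun s => _ ^ _) _ => unfold pow
  end.

(** * Integrals of continuous functions *)

Lemma RInt_le_continuous (f g : R -> R) (a b : R) :
  a <= b -> (forall t, continuous f t) -> (forall t, continuous g t) ->
  (forall t, a < t < b -> f t <= g t) -> RInt f a b <= RInt g a b.
Proof.
intros Hab Hf Hg H.
apply RInt_le; trivial; apply (ex_RInt_continuous (V := R_CompleteNormedModule)); auto.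
Qed.

Lemma RInt_plus_continuous (f g : R -> R) (a b : R) :
  (forall t, continuous f t) -> (forall t, continuous g t) ->
  RInt (fun t => f t + g t) a b = RInt f a b + RInt g a b.
Proof.
intros Hf Hg.
apply (RInt_plus (V := R_CompleteNormedModule));
  apply (ex_RInt_continuous (V := R_CompleteNormedModule)); auto.
Qed.

Lemma RInt_scal_continuous (f : R -> R) (c a b : R) :
  (forall t, continuous f t) -> RInt (fun t => c * f t) a b = c * RInt f a b.
Proof.
intros Hf.
apply (RInt_scal (V := R_CompleteNormedModule));
  apply (ex_RInt_continuous (V := R_CompleteNormedModule)); auto.
Qed.

Lemma RInt_Chasles_continuous (f : R -> R) (a b c : R) :
  (forall t, continuous f t) -> RInt f a b + RInt f b c = RInt f a c.
Proof.
intros Hf.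
apply (RInt_Chasles (V := R_CompleteNormedModule));
  apply (ex_RInt_continuous (V := R_CompleteNormedModule)); auto.
Qed.

Lemma is_derive_RInt_upper (g : R -> R) (a t : R) :
  (forall s, continuous g s) -> is_derive (fun s => RInt g a s) t (g t).
Proof.
intros Hg. apply (is_derive_RInt (V := R_NormedModule) g (fun s => RInt g a s) a t).
- apply filter_forall. intros s.
  apply (RInt_correct (V := R_CompleteNormedModule)), (ex_RInt_continuous (V := R_CompleteNormedModule)).
  intros; apply Hg.
- apply Hg.
Qed.

Lemma nondecreasing_of_derive (H dH : R -> R) (a b : R) :
  a <= b -> (forall s, continuous H s) ->
  (forall s, a < s < b -> is_derive H s (dH s) /\ 0 <= dH s) -> H a <= H b.
Proof.
intros Hab Hc Hd.
(* The mean value theorem may return an endpoint, where dH carries no information;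
   the positive part of dH agrees with dH inside and is nonnegative everywhere. *)
destruct (MVT_gen H a b (fun s => Rmax 0 (dH s))) as [c [_ Hval]].
- intros s Hs. rewrite Rmin_left, Rmax_right in Hs by exact Hab.
  destruct (Hd s Hs) as [H1 H2]. now rewrite Rmax_right.
- intros s _. apply continuity_pt_filterlim, Hc.
- assert (Hm := Rmax_l 0 (dH c)). nra.
Qed.

Lemma ex_RInt_slice (f : R -> R -> R) (t a b : R) :
  plane_continuous f -> ex_RInt (f t) a b.
Proof.
intros Hf. apply (ex_RInt_continuous (V := R_CompleteNormedModule)).
intros z _. now apply continuity_2d_pt_slice_x.
Qed.

Lemma abs_RInt_le_const_unordered (f : R -> R) (a b M : R) :
  ex_RInt f a b ->
  (forall x, Rmin a b <= x <= Rmax a b -> Rabs (f x) <= M) ->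
  Rabs (RInt f a b) <= Rabs (b - a) * M.
Proof.
intros Hf HM. destruct (Rle_dec a b) as [H|H].
- rewrite (Rabs_right (b - a)) by lra.
  apply abs_RInt_le_const; [exact H|exact Hf|].
  intros x Hx. apply HM. now rewrite Rmin_left, Rmax_right by exact H.
- rewrite <- (opp_RInt_swap (V := R_CompleteNormedModule)) by now apply ex_RInt_swap.
  change (opp (RInt f b a)) with (- RInt f b a).
  rewrite Rabs_Ropp, (Rabs_left (b - a)), Ropp_minus_distr by lra.
  apply abs_RInt_le_const; [lra|now apply ex_RInt_swap|].
  intros x Hx. apply HM. now rewrite Rmin_right, Rmax_left by lra.
Qed.

(** With this, integrals over slices with moving ends are continuous by composition
alone, and the limits taken below need no uniform estimate of their own. *)
Lemma plane_continuous_RInt (f : R -> R -> R) :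
  plane_continuous f -> plane_continuous (fun t y => RInt (f t) 0 y).
Proof.
intros Hf t y eps.
set (L := Rabs y + 1).
assert (HL : 0 < L) by (unfold L; generalize (Rabs_pos y); lra).
assert (He : 0 < eps / 4 / L) by (repeat apply Rdiv_lt_0_compat; try apply cond_pos; lra).
destruct (uniform_continuity_2d_1d' f (- L) L t (fun x _ => Hf t x) (mkposreal _ He))
  as [d Hd]; simpl in Hd.
assert (Hc : continuous (fun z => RInt (f t) 0 z) y).
{ apply (continuous_RInt_1 (f t) 0 y (fun z => RInt (f t) 0 z)).
  apply filter_forall. intros z.
  apply (RInt_correct (V := R_CompleteNormedModule)), ex_RInt_slice, Hf. }
apply continuity_pt_filterlim in Hc.
destruct (proj1 (continuity_pt_locally _ _) Hc (pos_div_2 eps)) as [d2 Hd2].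
assert (Hmin : 0 < Rmin d (Rmin d2 1)).
{ repeat apply Rmin_glb_lt; try apply cond_pos; lra. }
exists (mkposreal _ Hmin). intros u v Hu Hv; simpl in Hu, Hv.
assert (Hu1 := Rlt_le_trans _ _ _ Hu (Rmin_l _ _)).
assert (Hv1 := Rlt_le_trans _ _ _ Hv (Rmin_r _ _)).
assert (Hv2 := Rlt_le_trans _ _ _ Hv1 (Rmin_l _ _)).
assert (Hv3 := Rlt_le_trans _ _ _ Hv1 (Rmin_r _ _)).
assert (HvL : Rabs v <= L).
{ unfold L. replace v with (y + (v - y)) by ring.
  eapply Rle_trans; [apply Rabs_triang|]. lra. }
(* First move the integrand at fixed endpoint, then the endpoint. *)
replace (RInt (f u) 0 v - RInt (f t) 0 y)
  with (RInt (fun x => f u x - f t x) 0 v + (RInt (f t) 0 v - RInt (f t) 0 y)).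
2:{ rewrite (RInt_minus (V := R_CompleteNormedModule)) by now apply ex_RInt_slice.
    change (@eq R (RInt (f u) 0 v - RInt (f t) 0 v + (RInt (f t) 0 v - RInt (f t) 0 y))
            (RInt (f u) 0 v - RInt (f t) 0 y)). ring. }
eapply Rle_lt_trans; [apply Rabs_triang|].
assert (H1 : Rabs (RInt (fun x => f u x - f t x) 0 v) <= L * (eps / 4 / L)).
{ eapply Rle_trans; [apply (abs_RInt_le_const_unordered _ 0 v (eps / 4 / L))|].
  - apply (ex_RInt_minus (V := R_NormedModule)); now apply ex_RInt_slice.
  - intros x Hx. apply Rlt_le.
    assert (HxL : - L <= x <= L).
    { apply Rabs_le_between in HvL. revert Hx.
      unfold Rmin, Rmax; destruct (Rle_dec 0 v); lra. }
    apply Rabs_def2 in Hu1. assert (Hp := cond_pos d).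
    apply Hd; try lra. rewrite Rminus_eq_0, Rabs_R0. exact Hp.
  - rewrite Rminus_0_r. apply Rmult_le_compat_r; lra. }
replace (L * (eps / 4 / L)) with (eps / 4) in H1 by (field; lra).
assert (H2 : Rabs (RInt (f t) 0 v - RInt (f t) 0 y) < eps / 2) by now apply Hd2.
assert (Hp := cond_pos eps). lra.
Qed.

Lemma RInt_slice_chasles (f : R -> R -> R) (t a b : R) :
  plane_continuous f -> RInt (f t) a b = RInt (f t) 0 b - RInt (f t) 0 a.
Proof.
intros Hf.
rewrite <- (RInt_Chasles (V := R_CompleteNormedModule) (f t) 0 a b) by now apply ex_RInt_slice.
symmetry. apply Rplus_minus_l.
Qed.

Lemma continuity_2d_pt_RInt_bounds (f a b p : R -> R -> R) (z t : R) :
  plane_continuous f ->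
  continuity_2d_pt p z t -> continuity_2d_pt a z t -> continuity_2d_pt b z t ->
  continuity_2d_pt (fun z t => RInt (f (p z t)) (a z t) (b z t)) z t.
Proof.
intros Hf Hp Ha Hb.
apply (continuity_2d_pt_ext
  (fun z t => RInt (f (p z t)) 0 (b z t) - RInt (f (p z t)) 0 (a z t))).
- intros u v. now rewrite (RInt_slice_chasles f _ (a u v) (b u v)).
- apply continuity_2d_pt_minus;
    apply (continuity_2d_pt_comp (fun t y => RInt (f t) 0 y)); trivial;
    now apply plane_continuous_RInt.
Qed.

(** Leibniz rule for a slice with moving ends. Only the t-derivative of e near the
slice enters; e is continuous everywhere, which settles integrability. *)
Lemma is_derive_RInt_slice (e et : R -> R -> R) (a b : R -> R) (t da db r : R) :
  plane_continuous e -> 0 < r -> a t <= b t ->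
  (forall s x, Rabs (s - t) < r -> a t - r <= x <= b t + r ->
     is_derive (fun u => e u x) s (et s x) /\ continuity_2d_pt et s x) ->
  is_derive a t da -> is_derive b t db ->
  is_derive (fun s => RInt (e s) (a s) (b s)) t
    (RInt (et t) (a t) (b t) + - e t (a t) * da + e t (b t) * db).
Proof.
intros He Hr Hab Hd Ha Hb.
assert (Hr2 : 0 < r / 2) by lra.
assert (HD : forall s x, Rabs (s - t) < r -> a t - r <= x <= b t + r ->
  Derive (fun u => e u x) s = et s x).
{ intros s x Hs Hx. apply is_derive_unique. now apply Hd. }
assert (HC : forall s x, Rabs (s - t) < r / 2 -> a t - r / 2 <= x <= b t + r / 2 ->
  continuity_2d_pt (fun u v => Derive (fun z => e z v) u) s x).
{ intros s x Hs Hx.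
  apply (continuity_2d_pt_ext_loc et).
  - exists (mkposreal _ Hr2). intros u v Hu Hv; simpl in Hu, Hv. symmetry. apply HD.
    + replace (u - t) with ((u - s) + (s - t)) by ring.
      eapply Rle_lt_trans; [apply Rabs_triang|]. lra.
    + apply Rabs_def2 in Hv. lra.
  - apply Hd; lra. }
assert (H0 : Rabs (t - t) < r / 2) by (rewrite Rminus_eq_0, Rabs_R0; exact Hr2).
replace (RInt (et t) (a t) (b t)) with (RInt (fun x => Derive (fun u => e u x) t) (a t) (b t)).
2:{ apply RInt_ext. intros x Hx. rewrite Rmin_left, Rmax_right in Hx by exact Hab.
    apply HD; lra. }
apply (is_derive_RInt_param_bound_comp e a b t da db).
- apply filter_forall. intros y. now apply ex_RInt_slice.
- exists (mkposreal _ Hr). apply filter_forall. intros y. now apply ex_RInt_slice.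
- exists (mkposreal _ Hr). apply filter_forall. intros y. now apply ex_RInt_slice.
- exact Ha.
- exact Hb.
- exists (mkposreal _ Hr). exists (mkposreal _ Hr). simpl. intros s Hs x Hx.
  rewrite Rmin_left, Rmax_right in Hx by lra.
  exists (et s x). now apply Hd.
- intros x Hx. rewrite Rmin_left, Rmax_right in Hx by exact Hab. apply HC; lra.
- exists (mkposreal _ Hr2). simpl. intros u v Hu Hv. apply Rabs_def2 in Hv. apply HC; lra.
- exists (mkposreal _ Hr2). simpl. intros u v Hu Hv. apply Rabs_def2 in Hv. apply HC; lra.
- apply continuity_pt_filterlim, continuity_2d_pt_slice_x, He.
- apply continuity_pt_filterlim, continuity_2d_pt_slice_x, He.
Qed.

(** * The flux inequality *)

(** The divergence theorem as an inequality, with no double integral: if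
d/dt e >= d/dx f between the curves a and b, the energy of the slice grows at
least by the net flux f + a' e through the two curves. The derivatives are only
needed strictly between a and b, while e and f are continuous up to these curves:
one applies the Leibniz rule along curves shrunk towards each other, where the
energy minus the accumulated flux is nondecreasing in time, and then lets them
tend to a and b. The curves may meet at the two end times, so triangles are
allowed. *)
Lemma flux_inequality (e f et fx : R -> R -> R) (a b da db : R -> R) (t1 t2 : R) :
  plane_continuous e -> plane_continuous f -> t1 <= t2 ->
  (forall t, is_derive a t (da t)) -> (forall t, is_derive b t (db t)) ->
  (forall t, continuous da t) -> (forall t, continuous db t) ->
  (forall t, t1 < t < t2 -> a t < b t) ->
  (forall t x, t1 < t < t2 -> a t < x < b t ->
     is_derive (fun s => e s x) t (et t x) /\ is_derive (f t) x (fx t x) /\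
     continuity_2d_pt et t x /\ continuity_2d_pt fx t x /\ fx t x <= et t x) ->
  RInt (fun t => f t (b t) + db t * e t (b t) - (f t (a t) + da t * e t (a t))) t1 t2
  <= RInt (e t2) (a t2) (b t2) - RInt (e t1) (a t1) (b t1).
Proof.
intros He Hf Ht Ha Hb Hda Hdb Hab Hint.
(* For 0 < z < 1/2 the curves al z and be z lie strictly between a and b, so the
   Leibniz rule applies along them; z = 0 gives back a and b. *)
set (al := fun z t => (1 - z) * a t + z * b t).
set (be := fun z t => (1 - z) * b t + z * a t).
set (dal := fun z t => (1 - z) * da t + z * db t).
set (dbe := fun z t => (1 - z) * db t + z * da t).
assert (Hca : forall t, continuous a t) by (intros t; now apply is_derive_continuous with (da t)).
assert (Hcb : forall t, continuous b t) by (intros t; now apply is_derive_continuous with (db t)).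
assert (Hal := plane_continuous_interpolation _ _ Hca Hcb).
assert (Hbe := plane_continuous_interpolation _ _ Hcb Hca).
assert (Hdal := plane_continuous_interpolation _ _ Hda Hdb).
assert (Hdbe := plane_continuous_interpolation _ _ Hdb Hda).
fold al in Hal. fold be in Hbe. fold dal in Hdal. fold dbe in Hdbe.
set (Bd := fun z t => f t (be z t) + dbe z t * e t (be z t)
                      - (f t (al z t) + dal z t * e t (al z t))).
assert (HBd : plane_continuous Bd).
{ intros z t. unfold Bd.
  assert (Hon : forall g p, plane_continuous g -> plane_continuous p ->
    continuity_2d_pt (fun z t => g t (p z t)) z t).
  { intros g p Hg Hp. apply (continuity_2d_pt_comp g (fun _ t => t) p).
    - apply continuity_2d_pt_id2.
    - apply Hp.
    - apply Hg. }
  apply continuity_2d_pt_minus; apply continuity_2d_pt_plus;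
    try apply continuity_2d_pt_mult; auto. }
set (En := fun z t => RInt (e t) (al z t) (be z t)).
assert (HEn : plane_continuous En).
{ intros z t. apply (continuity_2d_pt_RInt_bounds e al be (fun _ t => t)); auto.
  apply continuity_2d_pt_id2. }
set (h := fun z => En z t2 - En z t1 - RInt (Bd z) t1 t2).
assert (Hh : continuous h 0).
{ apply (continuity_2d_pt_slice_t (fun z (_ : R) => h z) 0 0). unfold h.
  repeat apply continuity_2d_pt_minus.
  - apply continuity_2d_pt_of_t, continuity_2d_pt_slice_t, HEn.
  - apply continuity_2d_pt_of_t, continuity_2d_pt_slice_t, HEn.
  - apply (continuity_2d_pt_RInt_bounds Bd (fun _ _ => t1) (fun _ _ => t2) (fun z _ => z));
      try apply continuity_2d_pt_const; trivial. apply continuity_2d_pt_id1. }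
assert (Hpos : forall z, 0 < z < 1 / 2 -> 0 <= h z).
{ intros z Hz. unfold h.
  set (H := fun s => En z s - RInt (Bd z) t1 s).
  set (dH := fun s => RInt (et s) (al z s) (be z s) + - e s (al z s) * dal z s
                      + e s (be z s) * dbe z s - Bd z s).
  assert (HcB : forall s, continuous (Bd z) s).
  { intros s. apply continuity_2d_pt_slice_x, HBd. }
  assert (Hmono : H t1 <= H t2).
  { apply (nondecreasing_of_derive H dH); [exact Ht| |].
    { intros s. apply (continuous_minus (V := R_NormedModule)).
      - apply continuity_2d_pt_slice_x, HEn.
      - apply is_derive_continuous with (Bd z s). now apply is_derive_RInt_upper. }
    intros s Hs.
    assert (Hg : 0 < z * (b s - a s)).
    { apply Rmult_lt_0_compat; [lra|]. specialize (Hab s Hs). lra. }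
    set (g := z * (b s - a s)) in *.
    assert (Hg2 : 0 < g / 2) by lra.
    assert (Hal' : al z s = a s + g) by (unfold al, g; ring).
    assert (Hbe' : be z s = b s - g) by (unfold be, g; ring).
    assert (Hord : al z s <= be z s) by (unfold al, be; specialize (Hab s Hs); nra).
    split.
    - unfold H, dH. apply (is_derive_minus (V := R_NormedModule)).
      2:{ now apply is_derive_RInt_upper. }
      assert (HA := proj1 (continuity_pt_locally _ _) (proj2 (continuity_pt_filterlim _ _) (Hca s))
                    (mkposreal _ Hg2)).
      assert (HB := proj1 (continuity_pt_locally _ _) (proj2 (continuity_pt_filterlim _ _) (Hcb s))
                    (mkposreal _ Hg2)).
      destruct (filter_and _ _ HA HB) as [r Hr]; simpl in Hr.
      set (m := Rmin r (Rmin (g / 2) (Rmin (s - t1) (t2 - s)))).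
      assert (Hm : 0 < m) by (repeat apply Rmin_glb_lt; try apply cond_pos; lra).
      assert (Hmr : m <= r) by apply Rmin_l.
      assert (Hm1 : m <= Rmin (g / 2) (Rmin (s - t1) (t2 - s))) by apply Rmin_r.
      assert (Hmg : m <= g / 2) by (eapply Rle_trans; [exact Hm1|apply Rmin_l]).
      assert (Hm2 : m <= Rmin (s - t1) (t2 - s)) by (eapply Rle_trans; [exact Hm1|apply Rmin_r]).
      assert (Hm3 : m <= s - t1) by (eapply Rle_trans; [exact Hm2|apply Rmin_l]).
      assert (Hm4 : m <= t2 - s) by (eapply Rle_trans; [exact Hm2|apply Rmin_r]).
      apply (is_derive_RInt_slice e et (al z) (be z) s (dal z s) (dbe z s) m); trivial.
      + intros u x Hu Hx.
        assert (Hu' : ball s r u) by (change (Rabs (u - s) < r); lra).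
        destruct (Hr u Hu') as [Hau Hbu].
        apply Rabs_def2 in Hau. apply Rabs_def2 in Hbu. apply Rabs_def2 in Hu.
        destruct (Hint u x) as [D1 [D2 [D3 D4]]]; [lra|lra|]. split; assumption.
      + now apply is_derive_interpolation.
      + now apply is_derive_interpolation.
    - assert (Hin : forall x, al z s <= x <= be z s -> a s < x < b s) by (intros; lra).
      assert (Hfx : is_RInt (fx s) (al z s) (be z s) (f s (be z s) - f s (al z s))).
      { apply (is_RInt_derive (V := R_CompleteNormedModule) (f s) (fx s));
          intros x Hx; rewrite Rmin_left, Rmax_right in Hx by exact Hord.
        - now apply Hint, Hin.
        - apply continuity_2d_pt_slice_x. now apply Hint, Hin. }
      assert (Hle : f s (be z s) - f s (al z s) <= RInt (et s) (al z s) (be z s)).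
      { apply (is_RInt_le (fx s) (et s) (al z s) (be z s)); trivial.
        - apply (RInt_correct (V := R_CompleteNormedModule)), (ex_RInt_continuous (V := R_CompleteNormedModule)).
          intros x Hx; rewrite Rmin_left, Rmax_right in Hx by exact Hord.
          apply continuity_2d_pt_slice_x. now apply Hint, Hin.
        - intros x Hx. apply Hint; [exact Hs|]. lra. }
      unfold dH, Bd. lra. }
  unfold H in Hmono. rewrite RInt_point in Hmono. unfold zero in Hmono; simpl in Hmono. lra. }
assert (H0 := nonneg_at_0 h (1 / 2) ltac:(lra) Hh Hpos).
unfold h in H0.
assert (Hal0 : forall t, al 0 t = a t) by (intros t; unfold al; ring).
assert (Hbe0 : forall t, be 0 t = b t) by (intros t; unfold be; ring).
assert (HB0 : RInt (Bd 0) t1 t2 =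
  RInt (fun t => f t (b t) + db t * e t (b t) - (f t (a t) + da t * e t (a t))) t1 t2).
{ apply RInt_ext. intros t _. unfold Bd. rewrite Hal0, Hbe0.
  unfold dal, dbe. rewrite !Rmult_0_l, !Rplus_0_r, !Rminus_0_r, !Rmult_1_l. reflexivity. }
rewrite HB0 in H0. unfold En in H0. rewrite !Hal0, !Hbe0 in H0. lra.
Qed.

(** * Strips between timelike curves *)

Record timelike_strip (l1 l2 : R -> R) : Prop := {
  strip_derive1 : forall t, is_derive l1 t (Derive l1 t);
  strip_derive2 : forall t, is_derive l2 t (Derive l2 t);
  strip_C1_1 : forall t, continuous (Derive l1) t;
  strip_C1_2 : forall t, continuous (Derive l2) t;
  strip_speed1 : forall t, Rabs (Derive l1 t) < 1;
  strip_speed2 : forall t, Rabs (Derive l2 t) < 1;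
  strip_open : forall t, l1 t < l2 t }.

Lemma strip_continuous1 (l1 l2 : R -> R) :
  timelike_strip l1 l2 -> forall t, continuous l1 t.
Proof. intros HS t. exact (is_derive_continuous _ _ _ (strip_derive1 _ _ HS t)). Qed.

Lemma strip_continuous2 (l1 l2 : R -> R) :
  timelike_strip l1 l2 -> forall t, continuous l2 t.
Proof. intros HS t. exact (is_derive_continuous _ _ _ (strip_derive2 _ _ HS t)). Qed.

Lemma strip_open_2d (l1 l2 : R -> R) (t x : R) :
  timelike_strip l1 l2 -> l1 t < x < l2 t ->
  locally (t, x) (fun p : R * R => l1 (fst p) < snd p < l2 (fst p)).
Proof.
intros HS Hx.
assert (C1 := is_derive_continuous _ _ _ (strip_derive1 _ _ HS t)).
assert (C2 := is_derive_continuous _ _ _ (strip_derive2 _ _ HS t)).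
apply continuity_pt_filterlim in C1. apply continuity_pt_filterlim in C2.
assert (He : 0 < Rmin (x - l1 t) (l2 t - x) / 2).
{ assert (0 < Rmin (x - l1 t) (l2 t - x)) by (apply Rmin_glb_lt; lra). lra. }
assert (He1 := Rmin_l (x - l1 t) (l2 t - x)). assert (He2 := Rmin_r (x - l1 t) (l2 t - x)).
set (eps := mkposreal _ He).
assert (L1 := proj1 (continuity_pt_locally _ _) C1 eps).
assert (L2 := proj1 (continuity_pt_locally _ _) C2 eps).
destruct (filter_and _ _ L1 L2) as [d Hd].
assert (Hm : 0 < Rmin d eps) by (apply Rmin_glb_lt; apply cond_pos).
exists (mkposreal _ Hm). intros [s y] [Hs Hy]; simpl in Hs, Hy |- *.
change (Rabs (s - t) < Rmin d eps) in Hs. change (Rabs (y - x) < Rmin d eps) in Hy.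
assert (Hs' : ball t d s) by (eapply Rlt_le_trans; [exact Hs|apply Rmin_l]).
assert (Hy' : Rabs (y - x) < eps) by (eapply Rlt_le_trans; [exact Hy|apply Rmin_r]).
destruct (Hd s Hs') as [H1 H2].
apply Rabs_def2 in H1. apply Rabs_def2 in H2. apply Rabs_def2 in Hy'.
unfold eps in *; simpl in *. lra.
Qed.

Lemma timelike_lipschitz (l : R -> R) (s t : R) :
  (forall r, is_derive l r (Derive l r)) -> (forall r, Rabs (Derive l r) < 1) ->
  s < t -> - (t - s) < l t - l s < t - s.
Proof.
intros Hd Hs Hst.
destruct (MVT_gen l s t (Derive l)) as [c [_ Hc]].
- intros; apply Hd.
- intros r _. apply continuity_pt_filterlim, is_derive_continuous with (Derive l r), Hd.
- rewrite Hc. assert (H := Rabs_def2 _ _ (Hs c)). nra.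
Qed.

Definition bounded_strip (l1 l2 : R -> R) (t0 t1 L : R) : Prop :=
  forall t, t0 <= t <= t1 -> Rabs (l1 t) <= L /\ Rabs (l2 t) <= L.

Lemma strip_reflection (l1 l2 : R -> R) :
  timelike_strip l1 l2 -> timelike_strip (fun t => - l2 t) (fun t => - l1 t).
Proof.
intros HS.
assert (E1 : forall t, Derive (fun t => - l1 t) t = - Derive l1 t) by (intros; apply Derive_opp).
assert (E2 : forall t, Derive (fun t => - l2 t) t = - Derive l2 t) by (intros; apply Derive_opp).
constructor; intros t; rewrite ?E1, ?E2.
- apply (is_derive_opp (V := R_NormedModule)), (strip_derive2 _ _ HS).
- apply (is_derive_opp (V := R_NormedModule)), (strip_derive1 _ _ HS).
- apply (continuous_ext (fun t => - Derive l2 t)); [now intros s; rewrite E2|].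
  apply (continuous_opp (V := R_NormedModule)), (strip_C1_2 _ _ HS).
- apply (continuous_ext (fun t => - Derive l1 t)); [now intros s; rewrite E1|].
  apply (continuous_opp (V := R_NormedModule)), (strip_C1_1 _ _ HS).
- rewrite Rabs_Ropp. apply (strip_speed2 _ _ HS).
- rewrite Rabs_Ropp. apply (strip_speed1 _ _ HS).
- assert (Ho := strip_open _ _ HS t). lra.
Qed.

Lemma closure_region (l1 l2 : R -> R) (t x : R) :
  l1 t < l2 t -> l1 t <= x <= l2 t -> closure (region l1 l2) (t, x).
Proof.
intros Ho Hx eps. assert (He := cond_pos eps).
set (m := (l1 t + l2 t) / 2).
(* Move x by at most eps / 2 towards the midpoint m. *)
assert (H : exists y, Rabs (y - x) < eps /\ l1 t < y < l2 t).
{ destruct (Rle_dec x m) as [Hm|Hm].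
  - exists (Rmin (x + eps / 2) m). unfold Rmin, m in *.
    destruct (Rle_dec _ _); split; try lra; apply Rabs_def1; lra.
  - exists (Rmax (x - eps / 2) m). unfold Rmax, m in *.
    destruct (Rle_dec _ _); split; try lra; apply Rabs_def1; lra. }
destruct H as [y [Hy Hin]].
exists (t, y). split; [split|exact Hin].
- apply ball_center.
- exact Hy.
Qed.

Definition clamp (a b x : R) : R := Rmax a (Rmin b x).

Lemma clamp_between (a b x : R) : a <= b -> a <= clamp a b x <= b.
Proof.
intros H. unfold clamp. split; [apply Rmax_l|apply Rmax_lub; [exact H|apply Rmin_l]].
Qed.

Lemma clamp_id (a b x : R) : a <= x <= b -> clamp a b x = x.
Proof. intros H. unfold clamp. rewrite Rmin_right, Rmax_right; lra. Qed.

Lemma clamp_continuous (l1 l2 : R -> R) :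
  (forall t, continuous l1 t) -> (forall t, continuous l2 t) ->
  plane_continuous (fun t x => clamp (l1 t) (l2 t) x).
Proof.
intros H1 H2 t x. unfold clamp.
apply continuity_2d_pt_Rmax; [now apply continuity_2d_pt_of_t|].
apply (continuity_2d_pt_ext (fun t x => - Rmax (- l2 t) (- x))).
- intros u v. unfold Rmax, Rmin. destruct (Rle_dec _ _), (Rle_dec _ _); lra.
- apply continuity_2d_pt_opp, continuity_2d_pt_Rmax; apply continuity_2d_pt_opp.
  + now apply continuity_2d_pt_of_t.
  + apply continuity_2d_pt_id2.
Qed.

(** Precomposing with the projection onto the closed strip along the slices extends a
function continuously to the plane. *)
Lemma continuous_on_extension (l1 l2 : R -> R) (g : R * R -> R) :
  timelike_strip l1 l2 -> continuous_on (closure (region l1 l2)) g ->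
  exists G : R -> R -> R, plane_continuous G /\
    forall t x, l1 t <= x <= l2 t -> G t x = g (t, x).
Proof.
intros HS Hg.
assert (Hl1 := strip_continuous1 _ _ HS).
assert (Hl2 := strip_continuous2 _ _ HS).
assert (Hin : forall t x, closure (region l1 l2) (t, clamp (l1 t) (l2 t) x)).
{ intros t x. assert (Ho := strip_open _ _ HS t).
  apply closure_region; [exact Ho|]. apply clamp_between. lra. }
exists (fun t x => g (t, clamp (l1 t) (l2 t) x)). split.
- intros t x. apply continuity_2d_pt_filterlim.
  intros P HP. specialize (Hg _ (Hin t x) P HP).
  unfold filtermap, within in Hg |- *.
  assert (Hc : filterlim (fun z : R * R => (fst z, clamp (l1 (fst z)) (l2 (fst z)) (snd z)))
                 (locally (t, x)) (locally (t, clamp (l1 t) (l2 t) x))).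
  { apply filterlim_locally. intros eps.
    destruct (clamp_continuous l1 l2 Hl1 Hl2 t x eps) as [d Hd].
    assert (Hm : 0 < Rmin d eps) by (apply Rmin_glb_lt; apply cond_pos).
    exists (mkposreal _ Hm). intros [s y] [Hs Hy]; simpl in Hs, Hy |- *. split; simpl.
    - eapply ball_le; [|exact Hs]. apply Rmin_r.
    - apply Hd; [eapply Rlt_le_trans; [exact Hs|apply Rmin_l]|eapply Rlt_le_trans; [exact Hy|apply Rmin_l]]. }
  generalize (Hc _ Hg). unfold filtermap. apply filter_imp.
  intros [s y] H. apply H, Hin.
- intros t x Hx. now rewrite clamp_id.
Qed.

Lemma continuous_on_closure_bounded (l1 l2 : R -> R) (f : R -> R -> R) (t0 t1 L : R) :
  timelike_strip l1 l2 -> bounded_strip l1 l2 t0 t1 L -> t0 <= t1 ->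
  continuous_on (closure (region l1 l2)) (uncurry f) ->
  exists M, 0 <= M /\ forall t x, t0 <= t <= t1 -> region l1 l2 (t, x) -> Rabs (f t x) <= M.
Proof.
intros HS HL Ht Hf.
destruct (continuous_on_extension l1 l2 _ HS Hf) as [G [CG EG]].
assert (HL0 : 0 <= L) by (eapply Rle_trans; [apply Rabs_pos|apply (HL t0); lra]).
destruct (plane_continuous_bounded G t0 t1 (- L) L CG Ht ltac:(lra)) as [M [HM HGM]].
exists M. split; [exact HM|]. intros t x Htt Hx. unfold region in Hx; simpl in Hx.
destruct (HL t Htt) as [B1 B2]. apply Rabs_le_between in B1. apply Rabs_le_between in B2.
change (f t x) with (uncurry f (t, x)). rewrite <- EG by lra. apply HGM; lra.
Qed.

(** * Waves and multipliers *)

(** The functions w, w_t, w_x are continuous on the whole plane, so that values on the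
boundary curves are plain function values; they are a C^1 function and its
derivatives only inside the strip. The wave equation enters only as the bound N on
its lower order terms over the time interval [t0, t1]. This is all that the
estimates use, it makes their constants visibly independent of the solution, and
it is stable under reflection. *)
Record dirichlet_wave (l1 l2 : R -> R) (t0 t1 N : R) : Type := {
  w : R -> R -> R;
  w_t : R -> R -> R;
  w_x : R -> R -> R;
  w_tt : R -> R -> R;
  w_tx : R -> R -> R;
  w_xx : R -> R -> R;
  w_cont : plane_continuous w;
  w_t_cont : plane_continuous w_t;
  w_x_cont : plane_continuous w_x;
  w_dirichlet1 : forall t, w t (l1 t) = 0;
  w_dirichlet2 : forall t, w t (l2 t) = 0;
  w_derive_t : forall t x, l1 t < x < l2 t -> is_derive (fun s => w s x) t (w_t t x);
  w_derive_x : forall t x, l1 t < x < l2 t -> is_derive (w t) x (w_x t x);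
  w_t_derive_t : forall t x, l1 t < x < l2 t -> is_derive (fun s => w_t s x) t (w_tt t x);
  w_t_derive_x : forall t x, l1 t < x < l2 t -> is_derive (w_t t) x (w_tx t x);
  w_x_derive_t : forall t x, l1 t < x < l2 t -> is_derive (fun s => w_x s x) t (w_tx t x);
  w_x_derive_x : forall t x, l1 t < x < l2 t -> is_derive (w_x t) x (w_xx t x);
  w_tt_cont : forall t x, l1 t < x < l2 t -> continuity_2d_pt w_tt t x;
  w_tx_cont : forall t x, l1 t < x < l2 t -> continuity_2d_pt w_tx t x;
  w_xx_cont : forall t x, l1 t < x < l2 t -> continuity_2d_pt w_xx t x;
  w_equation : forall t x, t0 <= t <= t1 -> l1 t < x < l2 t ->
    Rabs (w_tt t x - w_xx t x) <= N * (Rabs (w t x) + Rabs (w_t t x) + Rabs (w_x t x)) }.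

Arguments w {l1 l2 t0 t1 N}.
Arguments w_t {l1 l2 t0 t1 N}.
Arguments w_x {l1 l2 t0 t1 N}.
Arguments w_tt {l1 l2 t0 t1 N}.
Arguments w_tx {l1 l2 t0 t1 N}.
Arguments w_xx {l1 l2 t0 t1 N}.

(** The energy-momentum tensor of w contracted with d/dt and the multiplier
A d/dt + B d/dx, with zeroth order terms added (up to a factor 2). The
corresponding flux in x is the same expression with A and B exchanged. *)
Definition density {l1 l2 t0 t1 N} (u : dirichlet_wave l1 l2 t0 t1 N)
  (A B : R -> R -> R) (t x : R) : R :=
  A t x * (w_t u t x ^ 2 + w_x u t x ^ 2 + w u t x ^ 2)
  + 2 * B t x * (w_t u t x * w_x u t x).

Lemma density_continuous {l1 l2 t0 t1 N} (u : dirichlet_wave l1 l2 t0 t1 N) (A B : R -> R -> R) :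
  plane_continuous A -> plane_continuous B -> plane_continuous (density u A B).
Proof.
intros HA HB t x.
assert (H0 := w_cont _ _ _ _ _ u t x).
assert (H1 := w_t_cont _ _ _ _ _ u t x).
assert (H2 := w_x_cont _ _ _ _ _ u t x).
unfold density.
repeat first [ apply continuity_2d_pt_plus | apply continuity_2d_pt_mult | assumption
             | apply HA | apply HB | apply continuity_2d_pt_const ].
Qed.

Lemma Rabs_mult_le_squares (x y s : R) :
  x ^ 2 + y ^ 2 <= s -> 2 * (Rabs x * Rabs y) <= s.
Proof.
intros H. rewrite <- (pow2_abs x), <- (pow2_abs y) in H.
assert (H1 := pow2_ge_0 (Rabs x - Rabs y)). nra.
Qed.

(** The algebra behind the multiplier inequality: c and d collect the
derivatives of the multiplier and q the lower order terms of the equation.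
The constant 4 N + 1 comes from 2 |y| |q| <= 4 N S and 2 |p| |y| <= S, where
S = y^2 + z^2 + p^2. *)
Lemma multiplier_form_nonneg (a b d c q p y z N : R) :
  0 <= N -> Rabs q <= N * (Rabs p + Rabs y + Rabs z) ->
  (4 * N + 1) * (Rabs a + Rabs b) + Rabs d <= c ->
  0 <= c * (y ^ 2 + z ^ 2 + p ^ 2) + 2 * d * (y * z) + 2 * (a * y + b * z) * q
       + 2 * a * (p * y) - 2 * b * (p * z).
Proof.
intros HN Hq Hc.
set (S := y ^ 2 + z ^ 2 + p ^ 2) in *.
assert (Hp2 := pow2_ge_0 p). assert (Hy2 := pow2_ge_0 y). assert (Hz2 := pow2_ge_0 z).
assert (Hyz : 2 * (Rabs y * Rabs z) <= S) by (apply Rabs_mult_le_squares; unfold S; lra).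
assert (Hpy : 2 * (Rabs p * Rabs y) <= S) by (apply Rabs_mult_le_squares; unfold S; lra).
assert (Hpz : 2 * (Rabs p * Rabs z) <= S) by (apply Rabs_mult_le_squares; unfold S; lra).
assert (Hyy : 2 * (Rabs y * Rabs y) <= 2 * S).
{ assert (H := pow2_abs y). unfold S. nra. }
assert (Hzz : 2 * (Rabs z * Rabs z) <= 2 * S).
{ assert (H := pow2_abs z). unfold S. nra. }
assert (HS : 0 <= S) by (unfold S; lra).
assert (Ha := Rabs_pos a). assert (Hb := Rabs_pos b). assert (Hd := Rabs_pos d).
assert (Habs : forall v, - Rabs v <= v) by (intros v; generalize (Rle_abs (- v)); rewrite Rabs_Ropp; lra).
assert (Hq' : forall v, 0 <= v -> v * Rabs q <= v * (N * (Rabs p + Rabs y + Rabs z))).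
{ intros v Hv. now apply Rmult_le_compat_l. }
assert (Hyq : 2 * (Rabs y * Rabs q) <= 4 * N * S) by (specialize (Hq' _ (Rabs_pos y)); nra).
assert (Hzq : 2 * (Rabs z * Rabs q) <= 4 * N * S) by (specialize (Hq' _ (Rabs_pos z)); nra).
assert (B1 : Rabs d * (2 * (Rabs y * Rabs z)) <= Rabs d * S) by (now apply Rmult_le_compat_l).
assert (B2 : Rabs a * (2 * (Rabs y * Rabs q)) <= Rabs a * (4 * N * S)) by (now apply Rmult_le_compat_l).
assert (B3 : Rabs b * (2 * (Rabs z * Rabs q)) <= Rabs b * (4 * N * S)) by (now apply Rmult_le_compat_l).
assert (B4 : Rabs a * (2 * (Rabs p * Rabs y)) <= Rabs a * S) by (now apply Rmult_le_compat_l).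
assert (B5 : Rabs b * (2 * (Rabs p * Rabs z)) <= Rabs b * S) by (now apply Rmult_le_compat_l).
assert (C1 := Habs (d * (y * z))). rewrite !Rabs_mult in C1.
assert (C2 := Habs (a * (y * q))). rewrite !Rabs_mult in C2.
assert (C3 := Habs (b * (z * q))). rewrite !Rabs_mult in C3.
assert (C4 := Habs (a * (p * y))). rewrite !Rabs_mult in C4.
assert (C5 := Rle_abs (b * (p * z))). rewrite !Rabs_mult in C5.
assert (D : ((4 * N + 1) * (Rabs a + Rabs b) + Rabs d) * S <= c * S) by (now apply Rmult_le_compat_r).
nra.
Qed.

(** Multiplying the equation by A w_t + B w_x turns it into
d/dt (density A B) - d/dx (density B A) = a quadratic form in (w, w_t, w_x).
If A_t - B_x dominates the multiplier itself, as happens for exponential weights of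
a large rate, then this form is nonnegative and the flux inequality applies. *)
Lemma multiplier_inequality {l1 l2 t0 t1 N} (u : dirichlet_wave l1 l2 t0 t1 N)
  (A B At Ax Bt Bx : R -> R -> R) (a b da db : R -> R) (r1 r2 : R) :
  plane_continuous A -> plane_continuous B ->
  plane_continuous At -> plane_continuous Ax -> plane_continuous Bt -> plane_continuous Bx ->
  (forall t x, is_derive (fun s => A s x) t (At t x)) ->
  (forall t x, is_derive (A t) x (Ax t x)) ->
  (forall t x, is_derive (fun s => B s x) t (Bt t x)) ->
  (forall t x, is_derive (B t) x (Bx t x)) ->
  0 <= N -> t0 <= r1 -> r1 <= r2 -> r2 <= t1 ->
  (forall t, is_derive a t (da t)) -> (forall t, is_derive b t (db t)) ->
  (forall t, continuous da t) -> (forall t, continuous db t) ->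
  (forall t, r1 < t < r2 -> l1 t <= a t < b t /\ b t <= l2 t) ->
  (forall t x, r1 < t < r2 -> a t < x < b t ->
     (4 * N + 1) * (Rabs (A t x) + Rabs (B t x)) + Rabs (Bt t x - Ax t x) <= At t x - Bx t x) ->
  RInt (fun t => density u B A t (b t) + db t * density u A B t (b t)
                 - (density u B A t (a t) + da t * density u A B t (a t))) r1 r2
  <= RInt (density u A B r2) (a r2) (b r2) - RInt (density u A B r1) (a r1) (b r1).
Proof.
intros HA HB HAt HAx HBt HBx DAt DAx DBt DBx HN Hr1 Hr Hr2 Ha Hb Hda Hdb Hab Hm.
set (et := fun t x => At t x * (w_t u t x ^ 2 + w_x u t x ^ 2 + w u t x ^ 2)
  + A t x * (2 * w_t u t x * w_tt u t x + 2 * w_x u t x * w_tx u t x + 2 * w u t x * w_t u t x)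
  + 2 * Bt t x * (w_t u t x * w_x u t x)
  + 2 * B t x * (w_tt u t x * w_x u t x + w_t u t x * w_tx u t x)).
set (fx := fun t x => Bx t x * (w_t u t x ^ 2 + w_x u t x ^ 2 + w u t x ^ 2)
  + B t x * (2 * w_t u t x * w_tx u t x + 2 * w_x u t x * w_xx u t x + 2 * w u t x * w_x u t x)
  + 2 * Ax t x * (w_t u t x * w_x u t x)
  + 2 * A t x * (w_tx u t x * w_x u t x + w_t u t x * w_xx u t x)).
apply (flux_inequality (density u A B) (density u B A) et fx); trivial;
  try now apply density_continuous.
- intros t Ht. now apply Hab.
- intros t x Ht Hx. destruct (Hab t Ht) as [Hl1 Hl2].
  assert (Hin : l1 t < x < l2 t) by lra.
  assert (C0 := w_cont _ _ _ _ _ u t x).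
  assert (C1 := w_t_cont _ _ _ _ _ u t x).
  assert (C2 := w_x_cont _ _ _ _ _ u t x).
  assert (C3 := w_tt_cont _ _ _ _ _ u t x Hin).
  assert (C4 := w_tx_cont _ _ _ _ _ u t x Hin).
  assert (C5 := w_xx_cont _ _ _ _ _ u t x Hin).
  assert (P1 := w_derive_t _ _ _ _ _ u t x Hin).
  assert (P2 := w_derive_x _ _ _ _ _ u t x Hin).
  assert (P3 := w_t_derive_t _ _ _ _ _ u t x Hin).
  assert (P4 := w_t_derive_x _ _ _ _ _ u t x Hin).
  assert (P5 := w_x_derive_t _ _ _ _ _ u t x Hin).
  assert (P6 := w_x_derive_x _ _ _ _ _ u t x Hin).
  assert (Q1 := DAt t x). assert (Q2 := DAx t x).
  assert (Q3 := DBt t x). assert (Q4 := DBx t x).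
  split; [|split; [|split; [|split]]].
  + unfold density. auto_derive.
    * repeat split; eexists; eassumption.
    * assert (E1 : Derive (fun s : R => w u s x) t = w_t u t x) by now apply is_derive_unique.
      assert (E2 : Derive (fun s : R => w_t u s x) t = w_tt u t x) by now apply is_derive_unique.
      assert (E3 : Derive (fun s : R => w_x u s x) t = w_tx u t x) by now apply is_derive_unique.
      assert (E4 : Derive (fun s : R => A s x) t = At t x) by now apply is_derive_unique.
      assert (E5 : Derive (fun s : R => B s x) t = Bt t x) by now apply is_derive_unique.
      rewrite E1, E2, E3, E4, E5. unfold et. ring.
  + unfold density. auto_derive.
    * repeat split; eexists; eassumption.
    * assert (E1 : Derive (fun y : R => w u t y) x = w_x u t x) by now apply is_derive_unique.
      assert (E2 : Derive (fun y : R => w_t u t y) x = w_tx u t x) by now apply is_derive_unique.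
      assert (E3 : Derive (fun y : R => w_x u t y) x = w_xx u t x) by now apply is_derive_unique.
      assert (E4 : Derive (fun y : R => A t y) x = Ax t x) by now apply is_derive_unique.
      assert (E5 : Derive (fun y : R => B t y) x = Bx t x) by now apply is_derive_unique.
      rewrite E1, E2, E3, E4, E5. unfold fx. ring.
  + unfold et.
    repeat first [ apply continuity_2d_pt_plus | apply continuity_2d_pt_mult | assumption
             | apply HA | apply HB | apply HAt | apply HBt | apply continuity_2d_pt_const ].
  + unfold fx.
    repeat first [ apply continuity_2d_pt_plus | apply continuity_2d_pt_mult | assumption
             | apply HA | apply HB | apply HAx | apply HBx | apply continuity_2d_pt_const ].
  + assert (Hq := multiplier_form_nonneg (A t x) (B t x) (Bt t x - Ax t x) (At t x - Bx t x)
      (w_tt u t x - w_xx u t x) (w u t x) (w_t u t x) (w_x u t x) N HN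
      (w_equation _ _ _ _ _ u t x ltac:(lra) Hin) (Hm t x Ht Hx)).
    unfold et, fx. lra.
Qed.

(** * Fluxes through null rays and boundary curves *)

(** Values of integrals live in the carrier of a normed module, which has to be exposed
as R before ring applies. *)
Ltac real_ring := match goal with |- ?a = ?b => change (@eq R a b) end; ring.

Lemma w_differentiable {l1 l2 t0 t1 N} (u : dirichlet_wave l1 l2 t0 t1 N) (t x : R) :
  timelike_strip l1 l2 -> l1 t < x < l2 t ->
  differentiable_pt_lim (w u) t x (w_t u t x) (w_x u t x).
Proof.
intros HS Hx. apply filterdiff_differentiable_pt_lim.
apply (is_derive_filterdiff (w u) t x (w_t u) (w_x u t x)).
- generalize (strip_open_2d l1 l2 t x HS Hx). apply filter_imp.
  intros [s y] H; simpl in *. now apply w_derive_t.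
- now apply w_derive_x.
- apply (proj1 (continuity_2d_pt_filterlim (w_t u) t x)), w_t_cont.
Qed.

(** Since w = 0 along c, its derivative along c vanishes: w_t + c' w_x = 0. As w is only
C^1 up to the boundary from inside, the identity is obtained as a limit along
curves inside the strip. *)
Lemma dirichlet_tangential {l1 l2 t0 t1 N} (u : dirichlet_wave l1 l2 t0 t1 N) (c dc : R -> R) :
  timelike_strip l1 l2 ->
  (forall t, is_derive c t (dc t)) -> (forall t, continuous dc t) ->
  (forall t, l1 t <= c t <= l2 t) -> (forall t, w u t (c t) = 0) ->
  forall t, w_t u t (c t) = - dc t * w_x u t (c t).
Proof.
intros HS Hc Hdc Hin H0 t.
(* The curves cz z, 0 < z < 1, run inside the strip and tend to c as z -> 0;
   K z is the derivative of w along cz z. *)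
set (m := fun s => (1 - / 2) * l1 s + / 2 * l2 s).
set (dm := fun s => (1 - / 2) * Derive l1 s + / 2 * Derive l2 s).
set (cz := fun z s => (1 - z) * c s + z * m s).
set (dcz := fun z s => (1 - z) * dc s + z * dm s).
set (K := fun z s => w_t u s (cz z s) + dcz z s * w_x u s (cz z s)).
assert (Hm : forall s, is_derive m s (dm s)).
{ intros s. apply is_derive_interpolation; [apply (strip_derive1 _ _ HS)|apply (strip_derive2 _ _ HS)]. }
assert (Hdm : forall s, continuous dm s).
{ intros s.
  apply (continuity_2d_pt_slice_x (fun z s => (1 - z) * Derive l1 s + z * Derive l2 s)).
  apply plane_continuous_interpolation; [apply (strip_C1_1 _ _ HS)|apply (strip_C1_2 _ _ HS)]. }
assert (Hcz : plane_continuous cz).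
{ apply plane_continuous_interpolation; intros s; eapply is_derive_continuous; [apply Hc|apply Hm]. }
assert (Hdcz : plane_continuous dcz) by now apply plane_continuous_interpolation.
assert (Hon : forall g, plane_continuous g -> plane_continuous (fun z s => g s (cz z s))).
{ intros g Hg z s. apply (continuity_2d_pt_comp g (fun _ s => s) cz).
  - apply continuity_2d_pt_id2.
  - apply Hcz.
  - apply Hg. }
assert (HK : plane_continuous K).
{ intros z s. apply continuity_2d_pt_plus; [|apply continuity_2d_pt_mult; [apply Hdcz|]].
  - apply Hon, w_t_cont.
  - apply Hon, w_x_cont. }
assert (HKc : forall z s, continuous (K z) s) by (intros z s; apply continuity_2d_pt_slice_x, HK).
assert (Hint : forall z s, 0 < z < 1 -> l1 s < cz z s < l2 s).
{ intros z s Hz. unfold cz, m. assert (Ho := strip_open _ _ HS s). specialize (Hin s). nra. }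
assert (Hder : forall z s, 0 < z < 1 -> is_derive (fun r => w u r (cz z r)) s (K z s)).
{ intros z s Hz. apply is_derive_Reals.
  unfold K. replace (w_t u s (cz z s)) with (w_t u s (cz z s) * 1) by ring.
  rewrite (Rmult_comm (dcz z s)).
  apply (derivable_pt_lim_comp_2d (w u) (fun r => r) (cz z)).
  - apply w_differentiable; [exact HS|now apply Hint].
  - apply derivable_pt_lim_id.
  - apply is_derive_Reals. now apply is_derive_interpolation. }
(* The primitive of K 0 is the limit of the increments of w along cz z, and w
   vanishes on c. *)
assert (HI : forall s, RInt (K 0) t s = 0).
{ intros s.
  set (h := fun z => RInt (K z) t s - (w u s (cz z s) - w u t (cz z t))).
  assert (Hh : plane_continuous (fun z _ => h z)).
  { intros z r. unfold h. apply continuity_2d_pt_minus; [|apply continuity_2d_pt_minus].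
    - apply (continuity_2d_pt_RInt_bounds K (fun _ _ => t) (fun _ _ => s) (fun z _ => z));
        try apply continuity_2d_pt_const; trivial. apply continuity_2d_pt_id1.
    - apply continuity_2d_pt_of_t, (continuity_2d_pt_slice_t (fun z s => w u s (cz z s))).
      apply Hon, w_cont.
    - apply continuity_2d_pt_of_t, (continuity_2d_pt_slice_t (fun z s => w u s (cz z s))).
      apply Hon, w_cont. }
  assert (Hz : forall z, 0 < z < 1 -> h z = 0).
  { intros z Hz. unfold h. apply Rminus_diag_eq, is_RInt_unique.
    apply (is_RInt_derive (V := R_CompleteNormedModule) (fun r => w u r (cz z r))); auto. }
  assert (H1 := nonneg_at_0 h 1 Rlt_0_1 (continuity_2d_pt_slice_t _ _ 0 (Hh 0 0))
     ltac:(intros z Hz1; rewrite (Hz z Hz1); lra)).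
  assert (H2 := nonneg_at_0 (fun z => - h z) 1 Rlt_0_1
     (continuous_opp (V := R_NormedModule) _ _ (continuity_2d_pt_slice_t _ _ 0 (Hh 0 0)))
     ltac:(intros z Hz1; simpl; rewrite (Hz z Hz1); lra)).
  assert (Hend : forall r, w u r (cz 0 r) = 0).
  { intros r. replace (cz 0 r) with (c r) by (unfold cz; ring). apply H0. }
  unfold h in H1, H2. rewrite !Hend in H1, H2. lra. }
assert (HK0 : K 0 t = 0).
{ rewrite <- (is_derive_unique _ _ _ (is_derive_RInt_upper (K 0) t t (HKc 0))).
  rewrite (Derive_ext _ (fun _ => 0)) by exact HI. apply Derive_const. }
unfold K in HK0. replace (cz 0 t) with (c t) in HK0 by (unfold cz; ring).
replace (dcz 0 t) with (dc t) in HK0 by (unfold dcz; ring). lra.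
Qed.

(** The flux of a multiplier through a null ray of velocity sigma = 1 or -1, up to the
weight. Besides w itself it only sees the derivative of w along the ray. *)
Definition null_flux {l1 l2 t0 t1 N} (u : dirichlet_wave l1 l2 t0 t1 N) (sigma t x : R) : R :=
  (w_t u t x + sigma * w_x u t x) ^ 2 + w u t x ^ 2.

Lemma null_flux_continuous {l1 l2 t0 t1 N} (u : dirichlet_wave l1 l2 t0 t1 N) (sigma : R) :
  plane_continuous (null_flux u sigma).
Proof.
intros t x. unfold null_flux.
assert (H0 := w_cont _ _ _ _ _ u t x).
assert (H1 := w_t_cont _ _ _ _ _ u t x).
assert (H2 := w_x_cont _ _ _ _ _ u t x).
repeat first [ apply continuity_2d_pt_plus | apply continuity_2d_pt_mult | assumption
             | apply continuity_2d_pt_const ].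
Qed.

Lemma null_flux_nonneg {l1 l2 t0 t1 N} (u : dirichlet_wave l1 l2 t0 t1 N) (sigma t x : R) :
  0 <= null_flux u sigma t x.
Proof. unfold null_flux. apply Rplus_le_le_0_compat; apply pow2_ge_0. Qed.

Definition curve_flux {l1 l2 t0 t1 N} (u : dirichlet_wave l1 l2 t0 t1 N) (l : R -> R) (t : R) : R :=
  (1 - Derive l t ^ 2) * w_x u t (l t) ^ 2.

Lemma curve_flux_continuous {l1 l2 t0 t1 N} (u : dirichlet_wave l1 l2 t0 t1 N) (l : R -> R) (t : R) :
  (forall t, is_derive l t (Derive l t)) -> (forall t, continuous (Derive l) t) ->
  continuous (curve_flux u l) t.
Proof.
intros Hl Hdl. unfold curve_flux.
assert (H : continuous (fun t => w_x u t (l t)) t).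
{ apply continuous_along; [apply w_x_cont|]. eapply is_derive_continuous; apply Hl. }
solve_continuous; apply H.
Qed.

Lemma curve_flux_nonneg {l1 l2 t0 t1 N} (u : dirichlet_wave l1 l2 t0 t1 N) (l : R -> R) (t : R) :
  Rabs (Derive l t) < 1 -> 0 <= curve_flux u l t.
Proof.
intros Hl. apply Rabs_def2 in Hl. apply Rmult_le_pos; [nra|apply pow2_ge_0].
Qed.

(** On a Dirichlet boundary the flux is a multiple of w_x^2 whose sign is that of
B - A l', hence depends on the side of l' on which the velocity of the multiplier
lies. *)
Lemma density_dirichlet {l1 l2 t0 t1 N} (u : dirichlet_wave l1 l2 t0 t1 N)
  (A B : R -> R -> R) (l : R -> R) (t : R) :
  timelike_strip l1 l2 -> l = l1 \/ l = l2 ->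
  density u B A t (l t) + Derive l t * density u A B t (l t)
  = (B t (l t) - A t (l t) * Derive l t) * curve_flux u l t.
Proof.
intros HS Hl.
assert (H0 : forall s, w u s (l s) = 0).
{ destruct Hl as [-> | ->]; intros s; [apply w_dirichlet1|apply w_dirichlet2]. }
assert (H1 : w_t u t (l t) = - Derive l t * w_x u t (l t)).
{ apply (dirichlet_tangential u l (Derive l) HS).
  - destruct Hl as [-> | ->]; [apply (strip_derive1 _ _ HS)|apply (strip_derive2 _ _ HS)].
  - destruct Hl as [-> | ->]; [apply (strip_C1_1 _ _ HS)|apply (strip_C1_2 _ _ HS)].
  - intros s. assert (Ho := strip_open _ _ HS s). destruct Hl as [-> | ->]; lra.
  - exact H0. }
unfold density, curve_flux. rewrite H0, H1. ring.
Qed.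

Lemma density_null {l1 l2 t0 t1 N} (u : dirichlet_wave l1 l2 t0 t1 N)
  (A B : R -> R -> R) (sigma t x : R) :
  sigma ^ 2 = 1 ->
  density u B A t x + sigma * density u A B t x
  = (B t x + sigma * A t x) * null_flux u sigma t x.
Proof.
intros Hs. unfold density, null_flux.
apply Rminus_diag_uniq.
replace (_ - _) with
  ((1 - sigma ^ 2) * (B t x * w_x u t x ^ 2 + 2 * A t x * w_t u t x * w_x u t x
     + sigma * A t x * w_x u t x ^ 2)) by ring.
rewrite Hs. ring.
Qed.

(** The reflection x -> - x exchanges the two curves, so estimates from the left curve
also hold from the right one. *)
Lemma reflection {l1 l2 t0 t1 N} (u : dirichlet_wave l1 l2 t0 t1 N) :
  exists v : dirichlet_wave (fun t => - l2 t) (fun t => - l1 t) t0 t1 N,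
    forall t x, w v t x = w u t (- x) /\ w_t v t x = w_t u t (- x) /\ w_x v t x = - w_x u t (- x).
Proof.
assert (HR : forall g t x, continuity_2d_pt g t (- x) -> continuity_2d_pt (fun t x => g t (- x)) t x).
{ intros g t x Hg. apply (continuity_2d_pt_comp g (fun t _ => t) (fun _ x => - x)); trivial.
  - apply continuity_2d_pt_id1.
  - apply continuity_2d_pt_opp, continuity_2d_pt_id2. }
assert (HD : forall (g : R -> R) (x d : R), is_derive g (- x) d -> is_derive (fun y => g (- y)) x (- d)).
{ intros g x d Hg. replace (- d) with (-1 * d) by ring.
  apply (is_derive_comp (V := R_NormedModule) g (fun y => - y) x d (-1) Hg).
  auto_derive; [trivial|ring]. }
assert (HN : forall (g : R -> R) (x d : R), is_derive g x d -> is_derive (fun y => - g y) x (- d)).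
{ intros g x d Hg. now apply (is_derive_opp (V := R_NormedModule)). }
unshelve eexists (Build_dirichlet_wave (fun t => - l2 t) (fun t => - l1 t) t0 t1 N
  (fun t x => w u t (- x)) (fun t x => w_t u t (- x)) (fun t x => - w_x u t (- x))
  (fun t x => w_tt u t (- x)) (fun t x => - w_tx u t (- x)) (fun t x => w_xx u t (- x))
  _ _ _ _ _ _ _ _ _ _ _ _ _ _ _).
- intros t x. apply HR, w_cont.
- intros t x. apply HR, w_t_cont.
- intros t x. apply continuity_2d_pt_opp, HR, w_x_cont.
- intros t; simpl. rewrite Ropp_involutive. apply w_dirichlet2.
- intros t; simpl. rewrite Ropp_involutive. apply w_dirichlet1.
- intros t x Hx. apply w_derive_t. lra.
- intros t x Hx. apply HD, w_derive_x. lra.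
- intros t x Hx. apply w_t_derive_t. lra.
- intros t x Hx. apply HD, w_t_derive_x. lra.
- intros t x Hx. apply HN, w_x_derive_t. lra.
- intros t x Hx. assert (Hin : l1 t < - x < l2 t) by lra.
  assert (H := HN _ _ _ (HD _ _ _ (w_x_derive_x _ _ _ _ _ u t (- x) Hin))).
  now rewrite Ropp_involutive in H.
- intros t x Hx. apply HR, w_tt_cont. lra.
- intros t x Hx. apply continuity_2d_pt_opp, HR, w_tx_cont. lra.
- intros t x Hx. apply HR, w_xx_cont. lra.
- intros t x Ht Hx; simpl. rewrite Rabs_Ropp. apply w_equation; lra.
- intros t x. simpl. auto.
Qed.

(** * Control of the first slice by the boundary *)

Lemma exp_nondecreasing (x y : R) : x <= y -> exp x <= exp y.
Proof.
intros [H | ->]; [apply Rlt_le; now apply exp_increasing|apply Rle_refl].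
Qed.

Lemma exp_bounds (k x L : R) : 0 <= k -> Rabs x <= L -> exp (- (k * L)) <= exp (- k * x) <= exp (k * L).
Proof.
intros Hk Hx. apply Rabs_le_between in Hx.
split; apply exp_nondecreasing; nra.
Qed.

Lemma is_derive_exp_linear (k x : R) : is_derive (fun y => exp (k * y)) x (k * exp (k * x)).
Proof. auto_derive; [trivial|ring]. Qed.

Lemma continuous_exp_linear (k x : R) : continuous (fun y => exp (k * y)) x.
Proof. eapply is_derive_continuous, is_derive_exp_linear. Qed.

(** The multiplier exp (- k x) d/dx treats x as the time of the evolution: its flux is
nonnegative through null rays of either direction and is the data term on l1. *)
Lemma sideways_step {l1 l2 t0 t1 N} (u : dirichlet_wave l1 l2 t0 t1 N)
  (b : R -> R) (sigma k r1 r2 : R) :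
  timelike_strip l1 l2 -> sigma ^ 2 = 1 -> 0 <= N -> 4 * N + 1 <= k ->
  t0 <= r1 -> r1 <= r2 -> r2 <= t1 ->
  (forall t, is_derive b t sigma) ->
  (forall t, r1 < t < r2 -> l1 t < b t <= l2 t) ->
  RInt (fun t => exp (- k * b t) * null_flux u sigma t (b t)
                 - exp (- k * l1 t) * curve_flux u l1 t) r1 r2
  <= RInt (density u (fun _ _ => 0) (fun _ x => exp (- k * x)) r2) (l1 r2) (b r2)
     - RInt (density u (fun _ _ => 0) (fun _ x => exp (- k * x)) r1) (l1 r1) (b r1).
Proof.
intros HS Hs HN Hk H1 H2 H3 Hb Hin.
set (Z := fun _ _ : R => 0). set (B := fun _ x : R => exp (- k * x)).
assert (HZ : plane_continuous Z) by (intros t x; apply continuity_2d_pt_const).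
assert (HB : plane_continuous B).
{ intros t x. apply continuity_2d_pt_of_x, continuous_exp_linear. }
eapply Rle_trans; [|apply (multiplier_inequality u Z B Z Z Z (fun _ x => - k * exp (- k * x))
  l1 b (Derive l1) (fun _ => sigma) r1 r2)]; trivial.
- apply Req_le, RInt_ext. intros t _.
  rewrite (density_dirichlet u Z B l1 t HS (or_introl eq_refl)).
  rewrite (density_null u Z B sigma t (b t) Hs). unfold Z, B. real_ring.
- intros t x. apply continuity_2d_pt_of_x. solve_continuous. apply continuous_exp_linear.
- intros t x. apply (is_derive_const (V := R_NormedModule) 0 t).
- intros t x. apply (is_derive_const (V := R_NormedModule) 0 x).
- intros t x. apply (is_derive_const (V := R_NormedModule) (exp (- k * x)) t).
- intros t x. apply is_derive_exp_linear.
- apply (strip_derive1 _ _ HS).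
- apply (strip_C1_1 _ _ HS).
- intros t. apply continuous_const.
- intros t Ht. specialize (Hin t Ht). lra.
- intros t x _ _. unfold Z, B. rewrite Rminus_0_r, !Rabs_R0.
  assert (He := exp_pos (- k * x)). rewrite (Rabs_right (exp _)) by lra.
  nra.
Qed.

(** Consider the triangle between l1, the rightward ray from (t0, l1 t0) and the ray of
velocity -1 from (t0, l2 t0), which reaches l1 at time t0 + T1. Solving from l1 in
the direction of x, the data on l1 up to that time determine w in the triangle, and
in particular its energy on the piece of the first ray before the rays cross. The
energy on the other null side has the favourable sign and is dropped. *)
Lemma sideways_estimate {l1 l2 t0 t1 N} (u : dirichlet_wave l1 l2 t0 t1 N) (T1 L k : R) :
  timelike_strip l1 l2 -> bounded_strip l1 l2 t0 t1 L -> 0 <= N -> 4 * N + 1 <= k ->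
  0 < T1 -> t0 + T1 <= t1 -> l2 t0 - T1 = l1 (t0 + T1) ->
  RInt (fun t => null_flux u 1 t (l1 t0 + (t - t0))) t0 (t0 + (l2 t0 - l1 t0) / 2)
  <= exp (k * L) ^ 2 * RInt (curve_flux u l1) t0 (t0 + T1).
Proof.
intros HS HL HN Hk HT HT1 HT2.
assert (HS' := HS). destruct HS as [D1 D2 C1 C2 S1 S2 HO].
assert (Ho := HO t0).
(* At time tP the ray b1 from (t0, l1 t0) meets the ray b2 from (t0, l2 t0). *)
set (tP := t0 + (l2 t0 - l1 t0) / 2).
assert (HtP : tP <= t0 + T1).
{ assert (H := timelike_lipschitz l1 t0 (t0 + T1) D1 S1). unfold tP. lra. }
assert (HtP0 : t0 < tP) by (unfold tP; lra).
set (b1 := fun t => l1 t0 + (t - t0)). set (b2 := fun t => l2 t0 - (t - t0)).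
assert (Db1 : forall t, is_derive b1 t 1) by (intros t; unfold b1; auto_derive; [trivial|ring]).
assert (Db2 : forall t, is_derive b2 t (-1)) by (intros t; unfold b2; auto_derive; [trivial|ring]).
assert (In1 : forall t, t0 < t < tP -> l1 t < b1 t <= l2 t).
{ intros t Ht. unfold b1. unfold tP in Ht.
  assert (H1 := timelike_lipschitz l1 t0 t D1 S1). assert (H2 := timelike_lipschitz l2 t0 t D2 S2).
  lra. }
assert (In2 : forall t, tP < t < t0 + T1 -> l1 t < b2 t <= l2 t).
{ intros t Ht. unfold b2. unfold tP in Ht.
  assert (H1 := timelike_lipschitz l1 t (t0 + T1) D1 S1). assert (H2 := timelike_lipschitz l2 t0 t D2 S2).
  lra. }
(* The slices of the triangle end on b1 before tP and on b2 after tP.  They are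
   single points at t0 and at t0 + T1, so only the interior slice at tP remains,
   and it cancels in E1 + E2. *)
assert (E1 := sideways_step u b1 1 k t0 tP HS' ltac:(ring) HN Hk (Rle_refl _) ltac:(lra) ltac:(lra) Db1 In1).
assert (E2 := sideways_step u b2 (-1) k tP (t0 + T1) HS' ltac:(ring) HN Hk ltac:(lra) HtP HT1 Db2 In2).
replace (b1 t0) with (l1 t0) in E1 by (unfold b1; ring).
replace (b2 (t0 + T1)) with (l1 (t0 + T1)) in E2 by (unfold b2; lra).
replace (b2 tP) with (b1 tP) in E2 by (unfold b1, b2, tP; field).
rewrite RInt_point in E1, E2. unfold zero in E1, E2; simpl in E1, E2.
set (w0 := exp (- (k * L))). set (w1 := exp (k * L)).
assert (Hw0 : 0 < w0) by apply exp_pos. assert (Hw1 : 0 < w1) by apply exp_pos.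
assert (Hww : w1 * w0 = 1).
{ unfold w0, w1. rewrite <- exp_plus, Rplus_opp_r. apply exp_0. }
assert (Hcb1 : forall t, continuous b1 t) by (intros t; eapply is_derive_continuous, Db1).
assert (Hcb2 : forall t, continuous b2 t) by (intros t; eapply is_derive_continuous, Db2).
assert (Hcl1 : forall t, continuous l1 t) by (intros t; eapply is_derive_continuous, D1).
set (G1 := fun t => null_flux u 1 t (b1 t)).
assert (HG1 : forall t, continuous G1 t).
{ intros t. apply (continuous_along (null_flux u 1) b1); [apply null_flux_continuous|apply Hcb1]. }
set (G2 := fun t => null_flux u (-1) t (b2 t)).
assert (HG2 : forall t, continuous G2 t).
{ intros t. apply (continuous_along (null_flux u (-1)) b2); [apply null_flux_continuous|apply Hcb2]. }
set (J := curve_flux u l1) in *.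
assert (HJ : forall t, continuous J t) by (intros t; now apply curve_flux_continuous).
assert (HJ0 : forall t, 0 <= J t) by (intros t; now apply curve_flux_nonneg).
assert (Hexp : forall c : R -> R, (forall t, continuous c t) -> forall t, continuous (fun t : R => exp (- k * c t)) t).
{ intros c Hc t. apply (continuous_comp c (fun x => exp (- k * x))); [apply Hc|apply continuous_exp_linear]. }
assert (Hex1 := Hexp b1 Hcb1). assert (Hex2 := Hexp b2 Hcb2). assert (Hexl := Hexp l1 Hcl1).
assert (Hwl : forall t, t0 <= t <= t1 -> exp (- k * l1 t) <= w1).
{ intros t Ht. apply exp_bounds; [lra|]. now apply HL. }
assert (F1 : w0 * RInt G1 t0 tP - w1 * RInt J t0 tP
  <= RInt (fun t => exp (- k * b1 t) * G1 t - exp (- k * l1 t) * J t) t0 tP).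
{ replace (w0 * RInt G1 t0 tP - w1 * RInt J t0 tP)
    with (RInt (fun t => w0 * G1 t + (- w1) * J t) t0 tP).
  2:{ rewrite RInt_plus_continuous, !RInt_scal_continuous; trivial; try real_ring;
      intros t; solve_continuous. }
  apply RInt_le_continuous; [lra| | |].
  - intros t. solve_continuous.
  - intros t. solve_continuous; trivial.
  - intros t Ht. assert (H1 := Hwl t ltac:(lra)).
    assert (H2 : w0 <= exp (- k * b1 t)).
    { apply exp_bounds; [lra|]. specialize (In1 t Ht). destruct (HL t ltac:(lra)) as [B1 B2].
      apply Rabs_le_between in B1. apply Rabs_le_between in B2. apply Rabs_le_between. lra. }
    assert (H3 : 0 <= G1 t) by apply null_flux_nonneg. specialize (HJ0 t). nra. }
assert (F2 : - w1 * RInt J tP (t0 + T1)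
  <= RInt (fun t => exp (- k * b2 t) * G2 t - exp (- k * l1 t) * J t) tP (t0 + T1)).
{ rewrite <- RInt_scal_continuous by trivial.
  apply RInt_le_continuous; [lra| | |].
  - intros t. solve_continuous.
  - intros t. solve_continuous; trivial.
  - intros t Ht. assert (H1 := Hwl t ltac:(lra)).
    assert (H2 : 0 < exp (- k * b2 t)) by apply exp_pos.
    assert (H3 : 0 <= G2 t) by apply null_flux_nonneg. specialize (HJ0 t). nra. }
assert (HC := RInt_Chasles_continuous J t0 tP (t0 + T1) HJ).
unfold G1, G2 in F1, F2.
change (RInt (fun t => null_flux u 1 t (b1 t)) t0 tP <= w1 ^ 2 * RInt J t0 (t0 + T1)).
assert (HF : w0 * RInt (fun t => null_flux u 1 t (b1 t)) t0 tP <= w1 * RInt J t0 (t0 + T1)).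
{ rewrite <- HC. lra. }
apply (Rmult_le_compat_l w1) in HF; [|lra].
rewrite <- Rmult_assoc, Hww, Rmult_1_l in HF. eapply Rle_trans; [exact HF|]. right; ring.
Qed.

Definition energy_density {l1 l2 t0 t1 N} (u : dirichlet_wave l1 l2 t0 t1 N) (t x : R) : R :=
  w_t u t x ^ 2 + w_x u t x ^ 2 + w u t x ^ 2.

Definition energy {l1 l2 t0 t1 N} (u : dirichlet_wave l1 l2 t0 t1 N) (t : R) : R :=
  RInt (energy_density u t) (l1 t) (l2 t).

Lemma energy_density_continuous {l1 l2 t0 t1 N} (u : dirichlet_wave l1 l2 t0 t1 N) (t x : R) :
  continuous (energy_density u t) x.
Proof.
apply continuity_2d_pt_slice_x. unfold energy_density.
assert (H0 := w_cont _ _ _ _ _ u t x).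
assert (H1 := w_t_cont _ _ _ _ _ u t x).
assert (H2 := w_x_cont _ _ _ _ _ u t x).
repeat first [ apply continuity_2d_pt_plus | apply continuity_2d_pt_mult | assumption
             | apply continuity_2d_pt_const ].
Qed.

(** The first slice and the two null rays issuing from its ends form a triangle. With
the multiplier exp (k t) d/dt, the energy of the slice leaves through the two rays,
because the slice shrinks to a point at their crossing. *)
Lemma characteristic_estimate {l1 l2 t0 t1 N} (u : dirichlet_wave l1 l2 t0 t1 N) (k : R) :
  timelike_strip l1 l2 -> 0 <= N -> 4 * N + 1 <= k ->
  t0 + (l2 t0 - l1 t0) / 2 <= t1 ->
  exp (k * t0) * energy u t0
  <= exp (k * t1) *
     (RInt (fun t => null_flux u 1 t (l1 t0 + (t - t0))) t0 (t0 + (l2 t0 - l1 t0) / 2)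
      + RInt (fun t => null_flux u (-1) t (l2 t0 - (t - t0))) t0 (t0 + (l2 t0 - l1 t0) / 2)).
Proof.
intros HS HN Hk HtP1.
set (tP := t0 + (l2 t0 - l1 t0) / 2) in *.
assert (Ho := strip_open _ _ HS t0).
assert (HtP0 : t0 < tP) by (unfold tP; lra).
set (b1 := fun t => l1 t0 + (t - t0)). set (b2 := fun t => l2 t0 - (t - t0)).
assert (Db1 : forall t, is_derive b1 t 1) by (intros t; unfold b1; auto_derive; [trivial|ring]).
assert (Db2 : forall t, is_derive b2 t (-1)) by (intros t; unfold b2; auto_derive; [trivial|ring]).
assert (Hcb1 : forall t, continuous b1 t) by (intros t; eapply is_derive_continuous, Db1).
assert (Hcb2 : forall t, continuous b2 t) by (intros t; eapply is_derive_continuous, Db2).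
(* The slice between b1 and b2 is the full slice at t0 and a point at tP. *)
set (Z := fun _ _ : R => 0). set (A := fun t _ : R => exp (k * t)).
assert (HZ : plane_continuous Z) by (intros t x; apply continuity_2d_pt_const).
assert (HA : plane_continuous A).
{ intros t x. apply (continuity_2d_pt_of_t (fun t => exp (k * t))), continuous_exp_linear. }
assert (In : forall t, t0 < t < tP -> l1 t <= b1 t < b2 t /\ b2 t <= l2 t).
{ intros t Ht. unfold b1, b2. unfold tP in Ht.
  assert (H1 := timelike_lipschitz l1 t0 t (strip_derive1 _ _ HS) (strip_speed1 _ _ HS)).
  assert (H2 := timelike_lipschitz l2 t0 t (strip_derive2 _ _ HS) (strip_speed2 _ _ HS)).
  lra. }
assert (HM : RInt (fun t => density u Z A t (b2 t) + -1 * density u A Z t (b2 t)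
                 - (density u Z A t (b1 t) + 1 * density u A Z t (b1 t))) t0 tP
  <= RInt (density u A Z tP) (b1 tP) (b2 tP) - RInt (density u A Z t0) (b1 t0) (b2 t0)).
{ apply (multiplier_inequality u A Z (fun t _ => k * exp (k * t)) Z Z Z
     b1 b2 (fun _ => 1) (fun _ => -1) t0 tP); trivial; try lra.
  - intros t x. apply continuity_2d_pt_of_t. solve_continuous. apply continuous_exp_linear.
  - intros t x. apply is_derive_exp_linear.
  - intros t x. apply (is_derive_const (V := R_NormedModule) (exp (k * t)) x).
  - intros t x. apply (is_derive_const (V := R_NormedModule) 0 t).
  - intros t x. apply (is_derive_const (V := R_NormedModule) 0 x).
  - intros t. apply continuous_const.
  - intros t. apply continuous_const.
  - intros t x _ _. unfold Z, A. rewrite !Rminus_0_r, !Rabs_R0.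
    assert (He := exp_pos (k * t)). rewrite (Rabs_right (exp _)) by lra. nra. }
replace (b2 tP) with (b1 tP) in HM by (unfold b1, b2, tP; field).
rewrite RInt_point in HM. unfold zero in HM; simpl in HM.
replace (b1 t0) with (l1 t0) in HM by (unfold b1; ring).
replace (b2 t0) with (l2 t0) in HM by (unfold b2; ring).
assert (HE : RInt (density u A Z t0) (l1 t0) (l2 t0) = exp (k * t0) * energy u t0).
{ unfold energy. rewrite <- RInt_scal_continuous by apply energy_density_continuous.
  apply RInt_ext. intros x _. unfold density, energy_density, A, Z. real_ring. }
rewrite HE in HM.
set (G1 := fun t => null_flux u 1 t (b1 t)).
assert (HG1 : forall t, continuous G1 t).
{ intros t. apply (continuous_along (null_flux u 1) b1); [apply null_flux_continuous|apply Hcb1]. }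
set (G2 := fun t => null_flux u (-1) t (b2 t)).
assert (HG2 : forall t, continuous G2 t).
{ intros t. apply (continuous_along (null_flux u (-1)) b2); [apply null_flux_continuous|apply Hcb2]. }
change (exp (k * t0) * energy u t0 <= exp (k * t1) * (RInt G1 t0 tP + RInt G2 t0 tP)).
apply Rle_trans with (RInt (fun t => exp (k * t) * (G1 t + G2 t)) t0 tP).
- assert (HI : RInt (fun t => density u Z A t (b2 t) + -1 * density u A Z t (b2 t)
                 - (density u Z A t (b1 t) + 1 * density u A Z t (b1 t))) t0 tP
     = -1 * RInt (fun t => exp (k * t) * (G1 t + G2 t)) t0 tP).
  { rewrite <- RInt_scal_continuous.
    2:{ intros t. solve_continuous. apply continuous_exp_linear. }
    apply RInt_ext. intros t _.
    rewrite (density_null u A Z 1) by ring. rewrite (density_null u A Z (-1)) by ring.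
    unfold G1, G2, A, Z. real_ring. }
  rewrite HI in HM. lra.
- rewrite <- RInt_plus_continuous by trivial. rewrite <- RInt_scal_continuous.
  2:{ intros t. solve_continuous. }
  apply RInt_le_continuous; [lra| | |].
  + intros t. solve_continuous. apply continuous_exp_linear.
  + intros t. solve_continuous.
  + intros t Ht. apply Rmult_le_compat_r.
    * apply Rplus_le_le_0_compat; apply null_flux_nonneg.
    * apply exp_nondecreasing. nra.
Qed.

(** The two sideways estimates control the two null sides of the triangle standing on
the slice t = t0, and these control the energy of that slice. *)
Lemma boundary_control {l1 l2 t0 t1 N} (u : dirichlet_wave l1 l2 t0 t1 N) (T1 T2 L k : R) :
  timelike_strip l1 l2 -> bounded_strip l1 l2 t0 t1 L -> 0 <= N -> 4 * N + 1 <= k ->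
  0 < T1 -> t0 + T1 <= t1 -> l2 t0 - T1 = l1 (t0 + T1) ->
  0 < T2 -> t0 + T2 <= t1 -> l1 t0 + T2 = l2 (t0 + T2) ->
  exp (k * t0) * energy u t0
  <= exp (k * t1) * exp (k * L) ^ 2 *
     (RInt (curve_flux u l1) t0 (t0 + T1) + RInt (curve_flux u l2) t0 (t0 + T2)).
Proof.
intros HS HL HN Hk HT1 HT1' E1 HT2 HT2' E2.
assert (I1 := sideways_estimate u T1 L k HS HL HN Hk HT1 HT1' E1).
destruct (reflection u) as [v Hv].
assert (HL' : bounded_strip (fun t => - l2 t) (fun t => - l1 t) t0 t1 L).
{ intros t Ht. destruct (HL t Ht). now rewrite !Rabs_Ropp. }
assert (I2 := sideways_estimate v T2 L k (strip_reflection _ _ HS) HL' HN Hk HT2 HT2' ltac:(lra)).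
cbv beta in I2. replace (- l1 t0 - - l2 t0) with (l2 t0 - l1 t0) in I2 by ring.
rewrite (RInt_ext _ (fun t => null_flux u (-1) t (l2 t0 - (t - t0)))) in I2.
2:{ intros t _. unfold null_flux. destruct (Hv t (- l2 t0 + (t - t0))) as [-> [-> ->]].
    replace (- (- l2 t0 + (t - t0))) with (l2 t0 - (t - t0)) by ring. real_ring. }
rewrite (RInt_ext (curve_flux v _) (curve_flux u l2)) in I2.
2:{ intros t _. unfold curve_flux. rewrite Derive_opp.
    destruct (Hv t (- l2 t)) as [_ [_ ->]]. rewrite Ropp_involutive. real_ring. }
assert (HtP : t0 + (l2 t0 - l1 t0) / 2 <= t1).
{ assert (Ho := strip_open _ _ HS t0).
  assert (H := timelike_lipschitz l1 t0 (t0 + T1) (strip_derive1 _ _ HS) (strip_speed1 _ _ HS)).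
  lra. }
assert (I3 := characteristic_estimate u k HS HN Hk HtP).
eapply Rle_trans; [exact I3|]. rewrite Rmult_assoc.
apply Rmult_le_compat_l; [apply Rlt_le, exp_pos|]. lra.
Qed.

(** * Propagation to later times *)

(** The multiplier d/dt + m d/dx, weighted by exp (- k t), is timelike as |m| <= rho < 1,
so that its density controls the energy. At the boundary its velocity m points
inwards relative to the curves, hence the boundary terms have a good sign and no
boundary data are needed. This covers times at which the data on one of the curves
are no longer available. *)
Lemma forward_estimate {l1 l2 t0 t1 N} (u : dirichlet_wave l1 l2 t0 t1 N)
  (m mt mx : R -> R -> R) (rho M k r : R) :
  timelike_strip l1 l2 -> 0 <= N ->
  plane_continuous m -> plane_continuous mt -> plane_continuous mx ->
  (forall t x, is_derive (fun s => m s x) t (mt t x)) ->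
  (forall t x, is_derive (m t) x (mx t x)) ->
  (forall t x, t0 <= t <= t1 -> l1 t <= x <= l2 t -> Rabs (m t x) <= rho) ->
  (forall t x, t0 <= t <= t1 -> l1 t <= x <= l2 t -> Rabs (mt t x) + Rabs (mx t x) <= M) ->
  (forall t, t0 <= t <= t1 -> Derive l1 t <= m t (l1 t)) ->
  (forall t, t0 <= t <= t1 -> m t (l2 t) <= Derive l2 t) ->
  rho < 1 -> 2 * (4 * N + 1) + M <= k * (1 - rho) ->
  t0 <= r <= t1 ->
  (1 - rho) * exp (- k * r) * energy u r <= 2 * exp (- k * t0) * energy u t0.
Proof.
intros HS HN Hm Hmt Hmx Dmt Dmx Hrho HM Hm1 Hm2 Hrho1 Hk Hr.
set (A := fun t _ : R => - exp (- k * t)).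
set (B := fun t x : R => - exp (- k * t) * m t x).
assert (HA : plane_continuous A).
{ intros t x. apply (continuity_2d_pt_of_t (fun t => - exp (- k * t))). solve_continuous. apply continuous_exp_linear. }
assert (HB : plane_continuous B).
{ intros t x. apply continuity_2d_pt_mult; [apply HA|apply Hm]. }
assert (Hexp : forall t, 0 < exp (- k * t)) by (intros t; apply exp_pos).
assert (Hsp : forall t, t0 <= t <= t1 -> 0 <= rho).
{ intros t Ht. eapply Rle_trans; [apply Rabs_pos|apply (Hrho t (l1 t) Ht)].
  assert (Ho := strip_open _ _ HS t). lra. }
assert (HF : RInt (fun t => density u B A t (l2 t) + Derive l2 t * density u A B t (l2 t)
                 - (density u B A t (l1 t) + Derive l1 t * density u A B t (l1 t))) t0 r
  <= RInt (density u A B r) (l1 r) (l2 r) - RInt (density u A B t0) (l1 t0) (l2 t0)).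
{ apply (multiplier_inequality u A B (fun t _ => k * exp (- k * t)) (fun _ _ => 0)
    (fun t x => k * exp (- k * t) * m t x - exp (- k * t) * mt t x)
    (fun t x => - exp (- k * t) * mx t x) l1 l2 (Derive l1) (Derive l2) t0 r);
    trivial; try lra.
  - intros t x. apply continuity_2d_pt_of_t. solve_continuous. apply continuous_exp_linear.
  - intros t x. apply continuity_2d_pt_const.
  - intros t x. apply continuity_2d_pt_minus; apply continuity_2d_pt_mult;
      try apply Hm; try apply Hmt; apply continuity_2d_pt_of_t; solve_continuous;
      apply continuous_exp_linear.
  - intros t x. apply continuity_2d_pt_mult; [apply HA|apply Hmx].
  - intros t x. unfold A. auto_derive; [trivial|ring].
  - intros t x. apply (is_derive_const (V := R_NormedModule) (- exp (- k * t)) x).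
  - intros t x. unfold B. auto_derive.
    + repeat split. now exists (mt t x).
    + assert (E1 : Derive (fun s : R => m s x) t = mt t x) by now apply is_derive_unique.
      rewrite E1. ring.
  - intros t x. unfold B. auto_derive.
    + repeat split. now exists (mx t x).
    + assert (E1 : Derive (fun y : R => m t y) x = mx t x) by now apply is_derive_unique.
      rewrite E1. ring.
  - apply (strip_derive1 _ _ HS).
  - apply (strip_derive2 _ _ HS).
  - apply (strip_C1_1 _ _ HS).
  - apply (strip_C1_2 _ _ HS).
  - intros t Ht. assert (Ho := strip_open _ _ HS t). lra.
  - intros t x Ht Hx. unfold A, B. rewrite Rminus_0_r.
    assert (He := Hexp t). set (ex := exp (- k * t)) in *.
    assert (Hmb := Hrho t x ltac:(lra) ltac:(lra)).
    assert (Hmd := HM t x ltac:(lra) ltac:(lra)).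
    assert (Hn := Hsp t ltac:(lra)).
    assert (P0 := Rabs_pos (mt t x)). assert (P1 := Rabs_pos (mx t x)). assert (P2 := Rabs_pos (m t x)).
    replace (k * ex * m t x - ex * mt t x) with (ex * (k * m t x - mt t x)) by ring.
    rewrite !Rabs_mult, Rabs_Ropp, (Rabs_right ex) by lra.
    assert (Hk0 : 0 <= k) by nra.
    assert (H1 : Rabs (k * m t x - mt t x) <= k * Rabs (m t x) + Rabs (mt t x)).
    { unfold Rminus. eapply Rle_trans; [apply Rabs_triang|].
      rewrite Rabs_Ropp, Rabs_mult, (Rabs_right k) by lra. lra. }
    assert (H2 := Rle_abs (- mx t x)). rewrite Rabs_Ropp in H2.
    assert (H3 : (4 * N + 1) * (1 + Rabs (m t x)) + Rabs (k * m t x - mt t x) <= k + mx t x) by nra.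
    apply (Rmult_le_compat_l ex) in H3; lra. }
(* On the curve l the flux is B - A l' = exp (- k t) (l' - m) times a nonnegative
   quantity, and m lies above l1' on l1 and below l2' on l2. *)
assert (H0 : 0 <= RInt (fun t => density u B A t (l2 t) + Derive l2 t * density u A B t (l2 t)
                 - (density u B A t (l1 t) + Derive l1 t * density u A B t (l1 t))) t0 r).
{ apply RInt_ge_0; [lra| |].
  - apply (ex_RInt_continuous (V := R_CompleteNormedModule)). intros t _.
    assert (HD1 := density_continuous u A B HA HB). assert (HD2 := density_continuous u B A HB HA).
    assert (Hl1 := strip_continuous1 _ _ HS).
    assert (Hl2 := strip_continuous2 _ _ HS).
    assert (Hd1 := strip_C1_1 _ _ HS). assert (Hd2 := strip_C1_2 _ _ HS).
    solve_continuous; now apply continuous_along.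
  - intros t Ht.
    rewrite (density_dirichlet u A B l2 t HS (or_intror eq_refl)).
    rewrite (density_dirichlet u A B l1 t HS (or_introl eq_refl)).
    assert (J1 := curve_flux_nonneg u l1 t (strip_speed1 _ _ HS t)).
    assert (J2 := curve_flux_nonneg u l2 t (strip_speed2 _ _ HS t)).
    specialize (Hm1 t ltac:(lra)). specialize (Hm2 t ltac:(lra)).
    unfold A, B. assert (He := Hexp t).
    assert (P1 : 0 <= exp (- k * t) * ((Derive l2 t - m t (l2 t)) * curve_flux u l2 t)).
    { apply Rmult_le_pos; [lra|]. apply Rmult_le_pos; lra. }
    assert (P2 : 0 <= exp (- k * t) * ((m t (l1 t) - Derive l1 t) * curve_flux u l1 t)).
    { apply Rmult_le_pos; [lra|]. apply Rmult_le_pos; lra. }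
    lra. }
(* Since |m| <= rho < 1, the density is equivalent to the energy density. *)
assert (HTY : forall t x, t0 <= t <= t1 -> l1 t < x < l2 t ->
  (1 - rho) * energy_density u t x
  <= energy_density u t x + 2 * m t x * (w_t u t x * w_x u t x)
  <= 2 * energy_density u t x).
{ intros t x Ht Hx. specialize (Hrho t x Ht ltac:(lra)).
  assert (HS2 : 2 * (Rabs (w_t u t x) * Rabs (w_x u t x)) <= energy_density u t x).
  { apply Rabs_mult_le_squares. unfold energy_density. assert (H := pow2_ge_0 (w u t x)). lra. }
  assert (Hp : Rabs (m t x * (w_t u t x * w_x u t x)) <= rho * (energy_density u t x / 2)).
  { rewrite !Rabs_mult. apply Rmult_le_compat; try apply Rabs_pos; trivial.
    - apply Rmult_le_pos; apply Rabs_pos.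
    - lra. }
  apply Rabs_le_between in Hp.
  assert (Hs0 : 0 <= energy_density u t x).
  { eapply Rle_trans; [|exact HS2]. repeat apply Rmult_le_pos; try apply Rabs_pos. lra. }
  nra. }
assert (HEr : RInt (density u A B r) (l1 r) (l2 r) <= - ((1 - rho) * exp (- k * r)) * energy u r).
{ unfold energy. rewrite <- RInt_scal_continuous by apply energy_density_continuous.
  assert (Ho := strip_open _ _ HS r).
  apply RInt_le_continuous; [lra| | |].
  - intros x. apply continuity_2d_pt_slice_x, density_continuous; assumption.
  - intros x. apply (continuous_mult (K := R_AbsRing)); [apply continuous_const|apply energy_density_continuous].
  - intros x Hx. destruct (HTY r x Hr Hx) as [H1 _].
    apply (Rmult_le_compat_l (exp (- k * r))) in H1; [|apply Rlt_le, Hexp].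
    unfold density, A, B. unfold energy_density in *. lra. }
assert (HE0 : - (2 * exp (- k * t0)) * energy u t0 <= RInt (density u A B t0) (l1 t0) (l2 t0)).
{ unfold energy. rewrite <- RInt_scal_continuous by apply energy_density_continuous.
  assert (Ho := strip_open _ _ HS t0).
  apply RInt_le_continuous; [lra| | |].
  - intros x. apply (continuous_mult (K := R_AbsRing)); [apply continuous_const|apply energy_density_continuous].
  - intros x. apply continuity_2d_pt_slice_x, density_continuous; assumption.
  - intros x Hx. destruct (HTY t0 x ltac:(lra) Hx) as [_ H1].
    apply (Rmult_le_compat_l (exp (- k * t0))) in H1; [|apply Rlt_le, Hexp].
    unfold density, A, B. unfold energy_density in *. lra. }
lra.
Qed.

(** Take m affine in x on each slice, equal to rho on l1 and to - rho on l2, where rho < 1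
bounds both velocities on [t0, t1]. The bound 6 q on its derivatives uses that the
width of the strip is at least 1 / q and that the curves have speed less than 1. *)
Lemma exists_tilted_multiplier (l1 l2 : R -> R) (t0 t1 : R) :
  timelike_strip l1 l2 -> t0 <= t1 ->
  exists (m mt mx : R -> R -> R) (rho M : R),
  rho < 1 /\ 0 <= M /\
  plane_continuous m /\ plane_continuous mt /\ plane_continuous mx /\
  (forall t x, is_derive (fun s => m s x) t (mt t x)) /\
  (forall t x, is_derive (m t) x (mx t x)) /\
  (forall t x, t0 <= t <= t1 -> l1 t <= x <= l2 t -> Rabs (m t x) <= rho) /\
  (forall t x, t0 <= t <= t1 -> l1 t <= x <= l2 t -> Rabs (mt t x) + Rabs (mx t x) <= M) /\
  (forall t, t0 <= t <= t1 -> Derive l1 t <= m t (l1 t)) /\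
  (forall t, t0 <= t <= t1 -> m t (l2 t) <= Derive l2 t).
Proof.
intros HS Ht.
assert (HS' := HS). destruct HS as [D1 D2 C1 C2 S1 S2 HO].
assert (Hl1 := strip_continuous1 _ _ HS').
assert (Hl2 := strip_continuous2 _ _ HS').
destruct (continuous_bounded (Derive l1) t0 t1 Ht C1) as [s1 [_ Hs1]].
destruct (continuous_bounded (Derive l2) t0 t1 Ht C2) as [s2 [_ Hs2]].
set (rho := Rmax (Rabs (Derive l1 s1)) (Rabs (Derive l2 s2))).
assert (Hrho1 : rho < 1) by (apply Rmax_lub_lt; auto).
assert (Hrho0 : 0 <= rho) by (eapply Rle_trans; [apply Rabs_pos|apply Rmax_l]).
assert (Hd1 : forall t, t0 <= t <= t1 -> - rho <= Derive l1 t <= rho).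
{ intros t H. apply Rabs_le_between. eapply Rle_trans; [now apply Hs1|apply Rmax_l]. }
assert (Hd2 : forall t, t0 <= t <= t1 -> - rho <= Derive l2 t <= rho).
{ intros t H. apply Rabs_le_between. eapply Rle_trans; [now apply Hs2|apply Rmax_r]. }
assert (Hgc : forall t, continuous (fun t => / (l2 t - l1 t)) t).
{ intros t. apply (continuous_comp (fun t => l2 t - l1 t) Rinv).
  - solve_continuous.
  - apply continuous_Rinv. specialize (HO t). lra. }
destruct (continuous_bounded _ t0 t1 Ht Hgc) as [s3 [_ Hs3]].
set (q := Rabs (/ (l2 s3 - l1 s3))) in *.
assert (Hq : forall t, t0 <= t <= t1 -> 0 < / (l2 t - l1 t) <= q).
{ intros t H. specialize (Hs3 t H). specialize (HO t). split; [apply Rinv_0_lt_compat; lra|].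
  eapply Rle_trans; [apply Rle_abs|exact Hs3]. }
set (i := fun t => / (l2 t - l1 t)).
exists (fun t x => rho * ((l1 t + l2 t - 2 * x) * i t)).
exists (fun t x => rho * ((Derive l1 t + Derive l2 t) * i t
          - (l1 t + l2 t - 2 * x) * i t * ((Derive l2 t - Derive l1 t) * i t))).
exists (fun t x => rho * (-2 * i t)).
exists rho, (6 * q).
assert (Hi : forall t, (l2 t - l1 t) * i t = 1).
{ intros t. unfold i. field. specialize (HO t). lra. }
assert (Hu : forall t x, l1 t <= x <= l2 t -> 0 < i t -> - 1 <= (l1 t + l2 t - 2 * x) * i t <= 1).
{ intros t x Hx H. specialize (Hi t). nra. }
repeat match goal with |- _ /\ _ => split end.
- exact Hrho1.
- assert (H := Rabs_pos (/ (l2 s3 - l1 s3))). unfold q. lra.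
- intros t x.
  repeat first [ apply continuity_2d_pt_minus | apply continuity_2d_pt_plus | apply continuity_2d_pt_mult
    | apply continuity_2d_pt_const | apply continuity_2d_pt_id2
    | apply (continuity_2d_pt_of_t i), Hgc
    | apply (continuity_2d_pt_of_t l1), Hl1 | apply (continuity_2d_pt_of_t l2), Hl2 ].
- intros t x.
  repeat first [ apply continuity_2d_pt_minus | apply continuity_2d_pt_plus | apply continuity_2d_pt_mult
    | apply continuity_2d_pt_const | apply continuity_2d_pt_id2
    | apply (continuity_2d_pt_of_t i), Hgc
    | apply (continuity_2d_pt_of_t (Derive l1)), C1 | apply (continuity_2d_pt_of_t (Derive l2)), C2
    | apply (continuity_2d_pt_of_t l1), Hl1 | apply (continuity_2d_pt_of_t l2), Hl2 ].
- intros t x. apply (continuity_2d_pt_of_t (fun t => rho * (-2 * i t))). solve_continuous.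
- intros t x. unfold i. auto_derive.
  + assert (X1 : ex_derive (fun s : R => l1 s) t) by (exists (Derive l1 t); apply D1).
    assert (X2 : ex_derive (fun s : R => l2 s) t) by (exists (Derive l2 t); apply D2).
    specialize (HO t). repeat split; trivial. lra.
  + specialize (HO t). change (fun x0 : R => l1 x0) with l1. change (fun x0 : R => l2 x0) with l2.
    field. lra.
- intros t x. auto_derive; [trivial|ring].
- intros t x H Hx. destruct (Hq t H) as [Hq1 Hq2].
  rewrite Rabs_mult, (Rabs_right rho) by lra.
  assert (H1 := Hu t x Hx Hq1). apply Rabs_le_between in H1.
  assert (H2 := Rabs_pos ((l1 t + l2 t - 2 * x) * i t)). nra.
- intros t x H Hx. destruct (Hq t H) as [Hq1 Hq2]. fold (i t) in Hq1, Hq2.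
  assert (H1 := Hu t x Hx Hq1).
  assert (B1 := Rabs_def2 _ _ (S1 t)). assert (B2 := Rabs_def2 _ _ (S2 t)).
  set (y := (l1 t + l2 t - 2 * x) * i t) in *.
  assert (P1 : Rabs ((Derive l1 t + Derive l2 t) * i t - y * ((Derive l2 t - Derive l1 t) * i t)) <= 4 * q).
  { replace (_ - _) with (((Derive l1 t + Derive l2 t) - y * (Derive l2 t - Derive l1 t)) * i t) by ring.
    rewrite Rabs_mult, (Rabs_right (i t)) by lra.
    apply Rmult_le_compat; [apply Rabs_pos|lra| |exact Hq2].
    apply Rabs_le. nra. }
  assert (P2 : Rabs (-2 * i t) <= 2 * q) by (apply Rabs_le; lra).
  rewrite !(Rabs_mult rho), (Rabs_right rho) by lra.
  assert (H2 := Rabs_pos ((Derive l1 t + Derive l2 t) * i t - y * ((Derive l2 t - Derive l1 t) * i t))).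
  assert (H3 := Rabs_pos (-2 * i t)). nra.
- intros t H. replace ((l1 t + l2 t - 2 * l1 t) * i t) with ((l2 t - l1 t) * i t) by ring.
  rewrite Hi. specialize (Hd1 t H). lra.
- intros t H. replace ((l1 t + l2 t - 2 * l2 t) * i t) with (- ((l2 t - l1 t) * i t)) by ring.
  rewrite Hi. specialize (Hd2 t H). lra.
Qed.

(** * Solutions in the closed strip *)

Lemma smooth_C1 (l : R -> R) :
  smooth l -> (forall t, is_derive l t (Derive l t)) /\ (forall t, continuous (Derive l) t).
Proof.
intros Hl. split; intros t.
- apply Derive_correct, (Hl 1%nat t).
- apply (ex_derive_continuous (V := R_NormedModule)). exact (Hl 2%nat t).
Qed.

Lemma smooth_timelike_strip (l1 l2 : R -> R) :
  smooth l1 -> smooth l2 -> (forall s, l1 s < l2 s) ->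
  (forall s, Rabs (Derive l1 s) < 1) -> (forall s, Rabs (Derive l2 s) < 1) ->
  timelike_strip l1 l2.
Proof.
intros H1 H2 H3 H4 H5.
constructor; trivial; now apply smooth_C1.
Qed.

(** A solution that is C^2 inside and C^1 up to the boundary becomes a Dirichlet wave on
extending it and its first derivatives continuously; its traces are then
values of the extension. *)
Lemma dirichlet_wave_of_solution (l1 l2 : R -> R) (X : R -> R -> R * R) (V phi : R -> R -> R)
  (t0 t1 N : R) :
  timelike_strip l1 l2 -> 0 <= N ->
  (forall t x, t0 <= t <= t1 -> region l1 l2 (t, x) ->
     Rabs (fst (X t x)) <= N /\ Rabs (snd (X t x)) <= N /\ Rabs (V t x) <= N) ->
  Ck 2 (region l1 l2) phi -> Ck_closure 1 (region l1 l2) phi ->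
  (forall t x : R, region l1 l2 (t, x) ->
     box phi t x + nabla X phi t x + V t x * phi t x = 0) ->
  (forall t x : R, curve l1 (t, x) \/ curve l2 (t, x) -> phi t x = 0) ->
  exists u : dirichlet_wave l1 l2 t0 t1 N,
    (forall t, energy u t = slice_energy l1 l2 phi t) /\
    (forall t x, l1 t <= x <= l2 t -> trace (region l1 l2) (pd_x phi) (t, x) = w_x u t x).
Proof.
intros HS HN HB H2 [Hc [_ Hpd]] Heq Hdir.
destruct (Hpd 1%nat 0%nat (le_n _)) as [gt [Hgt Egt]].
destruct (Hpd 0%nat 1%nat (le_n _)) as [gx [Hgx Egx]].
destruct (continuous_on_extension l1 l2 _ HS Hc) as [F [CF EF]].
destruct (continuous_on_extension l1 l2 _ HS Hgt) as [Ft [CFt EFt]].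
destruct (continuous_on_extension l1 l2 _ HS Hgx) as [Fx [CFx EFx]].
unfold uncurry in EF; simpl in EF.
assert (EFt' : forall t x, l1 t < x < l2 t -> Ft t x = pd_t phi t x).
{ intros t x Hx. rewrite EFt by lra. now apply (Egt (t, x)). }
assert (EFx' : forall t x, l1 t < x < l2 t -> Fx t x = pd_x phi t x).
{ intros t x Hx. rewrite EFx by lra. now apply (Egx (t, x)). }
assert (EF' : forall t x, l1 t < x < l2 t -> F t x = phi t x) by (intros; apply EF; lra).
(* Inside the open strip derivatives only see the values there, so those of the
   extensions are those of phi. *)
assert (Hopen : forall t x, l1 t < x < l2 t ->
  locally_2d (fun s y => l1 s < y < l2 s) t x).
{ intros t x Hx. destruct (strip_open_2d l1 l2 t x HS Hx) as [d Hd].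
  exists d. intros s y Hs Hy. apply (Hd (s, y)). split; [exact Hs|exact Hy]. }
assert (Hloc_t : forall t x, l1 t < x < l2 t -> locally t (fun s => l1 s < x < l2 s)).
{ intros t x Hx. destruct (Hopen t x Hx) as [d Hd]. exists d. intros s Hs.
  apply Hd; [exact Hs|]. rewrite Rminus_eq_0, Rabs_R0. apply cond_pos. }
assert (Hloc_x : forall t x, l1 t < x < l2 t -> locally x (fun y => l1 t < y < l2 t)).
{ intros t x Hx. destruct (Hopen t x Hx) as [d Hd]. exists d. intros y Hy.
  apply Hd; [|exact Hy]. rewrite Rminus_eq_0, Rabs_R0. apply cond_pos. }
set (Dtt := fun t x => Derive (fun s => pd_t phi s x) t).
set (Dtx := fun t x => Derive (fun y => pd_t phi t y) x).
set (Dxx := fun t x => Derive (fun y => pd_x phi t y) x).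
assert (Hreg : forall t x, l1 t < x < l2 t ->
  ex_derive (fun s => phi s x) t /\ ex_derive (fun y => phi t y) x /\
  ex_derive (fun s => pd_t phi s x) t /\ ex_derive (fun y => pd_t phi t y) x /\
  ex_derive (fun s => pd_x phi s x) t /\ ex_derive (fun y => pd_x phi t y) x /\
  continuity_2d_pt Dtt t x /\ continuity_2d_pt Dtx t x /\
  continuity_2d_pt (fun t x => Derive (fun s => pd_x phi s x) t) t x /\ continuity_2d_pt Dxx t x).
{ intros t x Hx. assert (H := H2 (t, x) Hx). simpl in H. unfold Dtt, Dtx, Dxx, pd_t, pd_x. tauto. }
assert (Hschwarz : forall t x, l1 t < x < l2 t -> Derive (fun s => pd_x phi s x) t = Dtx t x).
{ intros t x Hx. apply Schwarz.
  - generalize (Hopen t x Hx). apply locally_2d_impl, locally_2d_forall.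
    intros s y Hy. destruct (Hreg s y Hy) as [A1 [A2 [A3 [A4 [A5 A6]]]]]. tauto.
  - apply (Hreg t x Hx).
  - apply (Hreg t x Hx). }
unshelve eexists (Build_dirichlet_wave l1 l2 t0 t1 N F Ft Fx Dtt Dtx Dxx
  CF CFt CFx _ _ _ _ _ _ _ _ _ _ _ _).
- intros t. assert (Ho := strip_open _ _ HS t). rewrite EF by lra. apply Hdir. now left.
- intros t. assert (Ho := strip_open _ _ HS t). rewrite EF by lra. apply Hdir. now right.
- intros t x Hx. rewrite EFt' by exact Hx.
  apply (is_derive_ext_loc (fun s => phi s x)).
  + generalize (Hloc_t t x Hx). apply filter_imp. intros s Hs. symmetry. now apply EF'.
  + apply Derive_correct, (Hreg t x Hx).
- intros t x Hx. rewrite EFx' by exact Hx.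
  apply (is_derive_ext_loc (fun y => phi t y)).
  + generalize (Hloc_x t x Hx). apply filter_imp. intros y Hy. symmetry. now apply EF'.
  + apply Derive_correct, (Hreg t x Hx).
- intros t x Hx.
  apply (is_derive_ext_loc (fun s => pd_t phi s x)).
  + generalize (Hloc_t t x Hx). apply filter_imp. intros s Hs. symmetry. now apply EFt'.
  + apply Derive_correct, (Hreg t x Hx).
- intros t x Hx.
  apply (is_derive_ext_loc (fun y => pd_t phi t y)).
  + generalize (Hloc_x t x Hx). apply filter_imp. intros y Hy. symmetry. now apply EFt'.
  + apply Derive_correct, (Hreg t x Hx).
- intros t x Hx. rewrite <- Hschwarz by exact Hx.
  apply (is_derive_ext_loc (fun s => pd_x phi s x)).
  + generalize (Hloc_t t x Hx). apply filter_imp. intros s Hs. symmetry. now apply EFx'.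
  + apply Derive_correct, (Hreg t x Hx).
- intros t x Hx.
  apply (is_derive_ext_loc (fun y => pd_x phi t y)).
  + generalize (Hloc_x t x Hx). apply filter_imp. intros y Hy. symmetry. now apply EFx'.
  + apply Derive_correct, (Hreg t x Hx).
- intros t x Hx. apply (Hreg t x Hx).
- intros t x Hx. apply (Hreg t x Hx).
- intros t x Hx. apply (Hreg t x Hx).
- intros t x Ht Hx. rewrite EF', EFt', EFx' by exact Hx.
  destruct (HB t x Ht Hx) as [B1 [B2 B3]].
  assert (He := Heq t x Hx). unfold box, nabla in He.
  change (Derive_n (fun s => phi s x) 2 t) with (Dtt t x) in He.
  change (Derive_n (fun y => phi t y) 2 x) with (Dxx t x) in He.
  replace (Dtt t x - Dxx t x)
    with (fst (X t x) * pd_t phi t x + snd (X t x) * pd_x phi t x + V t x * phi t x) by lra.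
  eapply Rle_trans; [apply Rabs_triang|]. eapply Rle_trans; [apply Rplus_le_compat_r, Rabs_triang|].
  rewrite !Rabs_mult.
  assert (P1 := Rabs_pos (pd_t phi t x)). assert (P2 := Rabs_pos (pd_x phi t x)).
  assert (P3 := Rabs_pos (phi t x)). nra.
- split.
  + intros t. unfold energy, slice_energy. assert (Ho := strip_open _ _ HS t).
    apply RInt_ext. intros x Hx. rewrite Rmin_left, Rmax_right in Hx by lra.
    unfold energy_density; simpl. now rewrite EF', EFt', EFx' by exact Hx.
  + intros t x Hx. simpl.
    apply trace_correct.
    * apply closure_region; [apply (strip_open _ _ HS)|exact Hx].
    * apply (filterlim_within_ext (region l1 l2) (fun p : R * R => Fx (fst p) (snd p))).
      -- intros [s y] Hp. now apply EFx'.
      -- apply (filterlim_filter_le_1 (F := locally (t, x))); [apply (filter_le_within (region l1 l2))|].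
         apply (proj1 (continuity_2d_pt_filterlim Fx t x)), CFx.
Qed.

(** The flux has the factor 1 - l'^2 where the length measure has its square root, which
is larger as both are at most 1. *)
Lemma curve_flux_le_curve_integral {l1 l2 t0 t1 N} (u : dirichlet_wave l1 l2 t0 t1 N)
  (l : R -> R) (h : R * R -> R) (a b c : R) :
  (forall t, is_derive l t (Derive l t)) -> (forall t, continuous (Derive l) t) ->
  (forall t, Rabs (Derive l t) < 1) -> a <= b -> b <= c ->
  (forall t, h (t, l t) = w_x u t (l t)) ->
  RInt (curve_flux u l) a b <= curve_integral l a c (fun p => Rabs (h p) ^ 2).
Proof.
intros D1 C1 S1 Hab Hbc Hh. unfold curve_integral.
assert (Hsq : forall t, 0 < 1 - Derive l t ^ 2 <= 1).
{ intros t. assert (H := Rabs_def2 _ _ (S1 t)). nra. }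
set (g := fun t => w_x u t (l t) ^ 2 * sqrt (1 - Derive l t ^ 2)).
assert (Hg : forall t, continuous g t).
{ intros t. assert (H : continuous (fun t => w_x u t (l t)) t).
  { apply continuous_along; [apply w_x_cont|]. exact (is_derive_continuous _ _ _ (D1 t)). }
  unfold g. apply (continuous_mult (K := R_AbsRing)); [solve_continuous; exact H|].
  apply (continuous_comp (fun t => 1 - Derive l t ^ 2) sqrt); [solve_continuous|apply continuous_sqrt]. }
rewrite (RInt_ext (fun s => Rabs (h (s, l s)) ^ 2 * sqrt (1 - Rabs (Derive l s) ^ 2)) g).
2:{ intros t _. unfold g. now rewrite Hh, !pow2_abs. }
rewrite <- (RInt_Chasles_continuous g a b c Hg).
assert (H1 : RInt (curve_flux u l) a b <= RInt g a b).
{ apply RInt_le_continuous; trivial.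
  - intros t. now apply curve_flux_continuous.
  - intros t _. unfold curve_flux, g. rewrite Rmult_comm.
    apply Rmult_le_compat_l; [apply pow2_ge_0|].
    destruct (Hsq t) as [H1 H2]. set (y := 1 - Derive l t ^ 2) in *.
    rewrite <- (sqrt_sqrt y) at 1 by lra.
    assert (H3 := sqrt_pos y). assert (H4 : sqrt y <= 1) by (rewrite <- sqrt_1; now apply sqrt_le_1_alt).
    nra. }
assert (H2 : 0 <= RInt g b c).
{ apply RInt_ge_0; trivial.
  - apply (ex_RInt_continuous (V := R_CompleteNormedModule)). auto.
  - intros t _. apply Rmult_le_pos; [apply pow2_ge_0|apply sqrt_pos]. }
lra.
Qed.

Theorem theorem5p6 :
  forall (l1 l2 : R -> R)
    (X : R -> R -> R * R) (V : R -> R -> R)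
    (tm tp1 tp2 T1 T2 : R),
  smooth l1 -> smooth l2 ->
  (forall s : R, l1 s < l2 s) ->
  (forall s : R, Rabs (Derive l1 s) < 1) ->
  (forall s : R, Rabs (Derive l2 s) < 1) ->
  Cinf_closure_field (region l1 l2) X ->
  Cinf_closure (region l1 l2) V ->
  0 < T1 -> l2 tm - T1 = l1 (tm + T1) ->
  0 < T2 -> l1 tm + T2 = l2 (tm + T2) ->
  tp1 > tm + T1 -> tp2 > tm + T2 ->
  exists C : R, C > 0 /\
    forall phi : R -> R -> R,
    Ck 2 (region l1 l2) phi ->
    Ck_closure 1 (region l1 l2) phi ->
    (forall t x : R, region l1 l2 (t, x) ->
       box phi t x + nabla X phi t x + V t x * phi t x = 0) ->
    (forall t x : R, curve l1 (t, x) \/ curve l2 (t, x) -> phi t x = 0) ->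
    forall tau : R, tau = tm \/ tau = tp1 \/ tau = tp2 ->
    slice_energy l1 l2 phi tau <=
      C * (curve_integral l1 tm tp1
             (fun p => (Rabs (trace (region l1 l2) (pd_x phi) p)) ^ 2)
           + curve_integral l2 tm tp2
             (fun p => (Rabs (trace (region l1 l2) (pd_x phi) p)) ^ 2)).
Proof.
intros l1 l2 X V tm tp1 tp2 T1 T2 Hl1 Hl2 Hlt Hs1 Hs2 [HX1 HX2] HV HT1 E1 HT2 E2 Hp1 Hp2.
assert (HS := smooth_timelike_strip l1 l2 Hl1 Hl2 Hlt Hs1 Hs2).
set (tM := Rmax tp1 tp2).
assert (HM1 : tp1 <= tM) by apply Rmax_l. assert (HM2 : tp2 <= tM) by apply Rmax_r.
assert (HtM : tm <= tM) by lra.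
assert (HL : exists L, bounded_strip l1 l2 tm tM L).
{ destruct (continuous_bounded l1 tm tM HtM (strip_continuous1 _ _ HS)) as [s1 [_ B1]].
  destruct (continuous_bounded l2 tm tM HtM (strip_continuous2 _ _ HS)) as [s2 [_ B2]].
  exists (Rmax (Rabs (l1 s1)) (Rabs (l2 s2))). intros t Ht. split.
  - eapply Rle_trans; [now apply B1|apply Rmax_l].
  - eapply Rle_trans; [now apply B2|apply Rmax_r]. }
destruct HL as [L HL].
destruct (continuous_on_closure_bounded l1 l2 _ tm tM L HS HL HtM (proj1 (HX1 0%nat))) as [N1 [HN1 B1]].
destruct (continuous_on_closure_bounded l1 l2 _ tm tM L HS HL HtM (proj1 (HX2 0%nat))) as [N2 [HN2 B2]].
destruct (continuous_on_closure_bounded l1 l2 _ tm tM L HS HL HtM (proj1 (HV 0%nat))) as [N3 [HN3 B3]].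
set (N := N1 + N2 + N3). assert (HN : 0 <= N) by (unfold N; lra).
destruct (exists_tilted_multiplier l1 l2 tm tM HS HtM)
  as [m [mt [mx [rho [M [Hrho [HM [Cm [Cmt [Cmx [Dmt [Dmx [Bm [Bdm [Bm1 Bm2]]]]]]]]]]]]]]].
(* k1 is the rate needed on the triangles; k2 is the rate needed for the tilted
   multiplier, whose timelike margin is 1 - rho. *)
set (k1 := 4 * N + 1).
set (k2 := (2 * (4 * N + 1) + M) / (1 - rho)).
assert (Hk2 : k2 * (1 - rho) = 2 * (4 * N + 1) + M) by (unfold k2; field; lra).
assert (Hk2p : 0 <= k2) by nra.
set (C1 := exp (k1 * tM) * exp (k1 * L) ^ 2 / exp (k1 * tm)).
set (C2 := 2 * exp (- k2 * tm) / ((1 - rho) * exp (- k2 * tM))).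
assert (HC1 : 0 < C1).
{ apply Rdiv_lt_0_compat; [|apply exp_pos]. apply Rmult_lt_0_compat; [apply exp_pos|].
  apply pow_lt, exp_pos. }
assert (He2 : 0 < (1 - rho) * exp (- k2 * tM)) by (apply Rmult_lt_0_compat; [lra|apply exp_pos]).
assert (HC2 : 0 < C2).
{ apply Rdiv_lt_0_compat; [|exact He2]. apply Rmult_lt_0_compat; [lra|apply exp_pos]. }
exists (C2 * C1). split; [apply Rmult_lt_0_compat; assumption|].
intros phi Hphi2 Hphi1 Heq Hdir tau Htau.
destruct (dirichlet_wave_of_solution l1 l2 X V phi tm tM N HS HN) as [u [Hen Htr]]; trivial.
{ intros t x Ht Hx. specialize (B1 t x Ht Hx). specialize (B2 t x Ht Hx). specialize (B3 t x Ht Hx).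
  unfold N. repeat split; lra. }
assert (Hr : tm <= tau <= tM) by (destruct Htau as [-> | [-> | ->]]; lra).
assert (F1 := boundary_control u T1 T2 L k1 HS HL HN (Rle_refl _) HT1 ltac:(lra) E1 HT2 ltac:(lra) E2).
assert (F2 := forward_estimate u m mt mx rho M k2 tau HS HN Cm Cmt Cmx Dmt Dmx Bm Bdm Bm1 Bm2
  Hrho (Req_le _ _ (eq_sym Hk2)) Hr).
assert (J1 := curve_flux_le_curve_integral u l1 (trace (region l1 l2) (pd_x phi)) tm (tm + T1) tp1
  (strip_derive1 _ _ HS) (strip_C1_1 _ _ HS) Hs1 ltac:(lra) ltac:(lra)
  ltac:(intros t; apply Htr; specialize (Hlt t); lra)).
assert (J2 := curve_flux_le_curve_integral u l2 (trace (region l1 l2) (pd_x phi)) tm (tm + T2) tp2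
  (strip_derive2 _ _ HS) (strip_C1_2 _ _ HS) Hs2 ltac:(lra) ltac:(lra)
  ltac:(intros t; apply Htr; specialize (Hlt t); lra)).
set (I1 := curve_integral l1 tm tp1 _) in *. set (I2 := curve_integral l2 tm tp2 _) in *.
rewrite <- Hen.
assert (G1 : energy u tm <= C1 * (I1 + I2)).
{ apply (Rmult_le_reg_l (exp (k1 * tm))); [apply exp_pos|].
  eapply Rle_trans; [exact F1|].
  replace (exp (k1 * tm) * (C1 * (I1 + I2))) with (exp (k1 * tM) * exp (k1 * L) ^ 2 * (I1 + I2)).
  2:{ unfold C1. field. apply Rgt_not_eq, exp_pos. }
  apply Rmult_le_compat_l; [|lra].
  apply Rmult_le_pos; [apply Rlt_le, exp_pos|apply pow_le, Rlt_le, exp_pos]. }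
assert (Hpos : 0 <= energy u tau).
{ apply RInt_ge_0.
  - apply Rlt_le, Hlt.
  - apply (ex_RInt_continuous (V := R_CompleteNormedModule)). intros x _. apply energy_density_continuous.
  - intros x _. unfold energy_density. repeat apply Rplus_le_le_0_compat; apply pow2_ge_0. }
assert (G2 : (1 - rho) * exp (- k2 * tM) * energy u tau <= 2 * exp (- k2 * tm) * energy u tm).
{ eapply Rle_trans; [|exact F2]. apply Rmult_le_compat_r; [exact Hpos|].
  apply Rmult_le_compat_l; [lra|]. apply exp_nondecreasing. nra. }
apply (Rmult_le_reg_l _ _ _ He2). eapply Rle_trans; [exact G2|].
replace ((1 - rho) * exp (- k2 * tM) * (C2 * C1 * (I1 + I2)))
  with (2 * exp (- k2 * tm) * (C1 * (I1 + I2))).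
2:{ unfold C2. field. split; [apply Rgt_not_eq, exp_pos|lra]. }
apply Rmult_le_compat_l; [|exact G1].
apply Rmult_le_pos; [lra|apply Rlt_le, exp_pos].
Qed.
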